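(* For every prime $p\ge5$ and every integer $m\ge1$, \[ M_{m,p}:=[q^{mp}]\,C(q)H(q^p)^m\equiv B_m\pmod{p^4}. \]
   Context: $A_n=27^n[z^n]\,{}_2F_1(\tfrac13,\tfrac13;1;z)^3$, $B_n=(-1)^nA_n$. $\chi_3(n)=\left(\frac{n}{3}\right)$; $C(q)=1+\sum_{n\ge1}c_nq^n$ with $c_n=3\sum_{d\mid n}\chi_3(d)d^4$; $t(q)=q\prod_{n\ge1}(1-q^{3n})^{12}(1-q^n)^{-12}$, $H(q)=q/t(q)$. Congruence mod $p^4$ means the difference lies in $p^4\mathbf{Z}_{(p)}$. *)

(* Defs.v *)
From mathcomp Require Import all_boot all_order all_algebra.

Set Implicit Arguments.
Unset Strict Implicit.
Unset Printing Implicit Defensive.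

Import GRing.Theory.

Local Open Scope ring_scope.

(* A formal power series over the rationals is its coefficient sequence; [f n]
   is the coefficient of the n-th power of the variable. *)
Definition fps := nat -> rat.

Definition fps_one : fps := fun n => (n == 0%N)%:R.

Definition fps_var : fps := fun n => (n == 1%N)%:R.

Definition fps_mul (f g : fps) : fps :=
  fun n => \sum_(i < n.+1) f i * g (n - i)%N.

Definition fps_exp (f : fps) (k : nat) : fps := iter k (fps_mul f) fps_one.

(* Multiplicative inverse, meaningful when [f 0 != 0]. *)
Fixpoint fps_inv_coefs (f : fps) (n : nat) : seq rat :=
  if n is n'.+1 then
    let s := fps_inv_coefs f n' in
    rcons s (- (f 0%N)^-1 * \sum_(i < n'.+1) f i.+1 * s`_(n' - i))
  else [:: (f 0%N)^-1].

Definition fps_inv (f : fps) : fps := fun n => (fps_inv_coefs f n)`_n.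

(* f(q^k), for k > 0 *)
Definition fps_dil (k : nat) (f : fps) : fps :=
  fun n => if (k %| n)%N then f (n %/ k)%N else 0.

(* (f(q) - f(0)) / q *)
Definition fps_shift (f : fps) : fps := fun n => f n.+1.

Fixpoint fps_partprod (F : nat -> fps) (N : nat) : fps :=
  if N is N'.+1 then fps_mul (fps_partprod F N') (F N) else fps_one.

(* The product of the F k over k >= 1, meaningful when F k = 1 mod q^k for all
   k >= 1: the n-th coefficient of the partial products is then constant from
   the n-th partial product on (lemma [fps_partprod_stable]). *)
Definition fps_infprod (F : nat -> fps) : fps := fun n => fps_partprod F n n.

Definition legendre (a p : nat) : int :=
  if (p %| a)%N then 0
  else if [exists x : 'I_p, x ^ 2 == a %[mod p]]%N then 1 else -1.

Definition chi3 (n : nat) : int := legendre n 3.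

Definition pochhammer (a : rat) (n : nat) : rat := \prod_(i < n) (a + i%:R).

Definition hyp2F1 (a b c : rat) : fps :=
  fun n => pochhammer a n * pochhammer b n / (pochhammer c n * (n`!)%:R).

Definition A (n : nat) : rat :=
  27%:R ^+ n * fps_exp (hyp2F1 (1 / 3%:R) (1 / 3%:R) 1) 3 n.

Definition B (n : nat) : rat := (-1) ^+ n * A n.

Definition c (n : nat) : int :=
  3 * \sum_(d <- divisors n) chi3 d * (d%:Z) ^+ 4.

Definition C : fps := fun n => if n == 0%N then 1 else (c n)%:~R.

Definition one_minus_q (k : nat) : fps :=
  fun n => (n == 0%N)%:R - (n == k)%:R.

(* (1 - q^(3k))^12 (1 - q^k)^(-12) *)
Definition t_factor (k : nat) : fps :=
  fps_mul (fps_exp (one_minus_q (3 * k)) 12)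
          (fps_exp (fps_inv (one_minus_q k)) 12).

Definition t : fps := fps_mul fps_var (fps_infprod t_factor).

(* q / t(q), computed as 1 / (t(q) / q); see lemma [H_mul_t]. *)
Definition H : fps := fps_inv (fps_shift t).

Definition M (m p : nat) : rat :=
  fps_mul C (fps_exp (fps_dil p H) m) (m * p)%N.

(* The localization of the integers at the prime p, inside the rationals. *)
Definition Zloc (p : nat) : pred rat := fun x => coprime p `|denq x|%N.

Definition congr_loc (p k : nat) (x y : rat) : Prop :=
  exists2 z : rat, z \in Zloc p & x - y = p%:R ^+ k * z.

Lemma size_fps_inv_coefs f n : size (fps_inv_coefs f n) = n.+1.
Proof. by elim: n => //= n IH; rewrite size_rcons IH. Qed.

Lemma nth_fps_inv_coefs f n i :
  (i <= n)%N -> (fps_inv_coefs f n)`_i = fps_inv f i.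
Proof.
elim: n => [|n IH]; first by case: i.
rewrite leq_eqVlt => /predU1P[-> //|]; rewrite ltnS => le_in.
by rewrite /= nth_rcons size_fps_inv_coefs ltnS le_in IH.
Qed.

Lemma fps_mul_inv f : f 0%N != 0 -> fps_mul f (fps_inv f) =1 fps_one.
Proof.
move=> f0 [|n]; rewrite /fps_mul /fps_one.
  by rewrite big_ord1 /= mulfV.
rewrite big_ord_recl {1}/fps_inv /= nth_rcons size_fps_inv_coefs ltnn eqxx.
rewrite mulNr mulrN mulVKf //.
under [X in _ + X]eq_bigr => i _.
  rewrite /= subSS -(@nth_fps_inv_coefs _ n) ?leq_subr //; over.
by rewrite /= addNr.
Qed.

Lemma fps_mulC f g : fps_mul f g =1 fps_mul g f.
Proof.
move=> n; rewrite /fps_mul (reindex_inj rev_ord_inj) /=.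
apply: eq_bigr => i _; rewrite mulrC subSS subKn //.
by rewrite -ltnS.
Qed.

(* f = 1 mod q^k *)
Definition one_mod (k : nat) (f : fps) :=
  forall i, (i < k)%N -> f i = fps_one i.

Lemma fps_partprod_stable (F : nat -> fps) :
    (forall k, (0 < k)%N -> one_mod k (F k)) ->
  forall N n, (n <= N)%N -> fps_partprod F N n = fps_infprod F n.
Proof.
move=> F1; elim=> [|N IH] n; first by case: n.
rewrite leq_eqVlt => /predU1P[-> //|]; rewrite ltnS => le_nN.
rewrite /= -(IH _ le_nN) fps_mulC /fps_mul big_ord_recl subn0 F1 // mul1r.
rewrite big1 ?addr0 // => i _; rewrite F1 ?mul0r //.
by rewrite lift0 ltnS (leq_trans (ltn_ord i)).
Qed.

Lemma one_mod_mul k f g : one_mod k f -> one_mod k g -> one_mod k (fps_mul f g).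
Proof.
move=> f1 g1 n lt_nk; rewrite /fps_mul big_ord_recl subn0 g1 //.
rewrite f1 ?(leq_ltn_trans _ lt_nk) // mul1r big1 ?addr0 // => i _.
by rewrite f1 ?mul0r // (leq_ltn_trans _ lt_nk) //=.
Qed.

Lemma one_mod_exp k f n : one_mod k f -> one_mod k (fps_exp f n).
Proof. by move=> f1; elim: n => //= n IH; apply: one_mod_mul. Qed.

Lemma one_mod_inv k f : (0 < k)%N -> one_mod k f -> one_mod k (fps_inv f).
Proof.
move=> k0 f1 n lt_nk; have f0 : f 0%N = 1 by rewrite f1.
rewrite -(fps_mul_inv _ (f := f)) ?f0 ?oner_neq0 //.
rewrite /fps_mul big_ord_recl subn0 f0 mul1r big1 ?addr0 // => i _.
by rewrite f1 ?mul0r // (leq_ltn_trans _ lt_nk) //=.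
Qed.

Lemma one_mod_one_minus_q k l : (k <= l)%N -> one_mod k (one_minus_q l).
Proof.
move=> le_kl i lt_ik; rewrite /one_minus_q (ltn_eqF (leq_trans lt_ik le_kl)).
exact: subr0.
Qed.

Lemma t_factor_one_mod k : (0 < k)%N -> one_mod k (t_factor k).
Proof.
move=> k0; apply: one_mod_mul; apply: one_mod_exp.
  by apply: one_mod_one_minus_q; rewrite leq_pmull.
exact/one_mod_inv/one_mod_one_minus_q.
Qed.

Lemma t_partprod_stable N n :
  (n <= N)%N -> fps_partprod t_factor N n = fps_infprod t_factor n.
Proof.
exact/fps_partprod_stable/t_factor_one_mod.
Qed.

Lemma t0 : t 0%N = 0.
Proof. by rewrite /t /fps_mul big_ord1 /fps_var mul0r. Qed.

Lemma t1 : t 1%N = 1.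
Proof.
rewrite /t /fps_mul !big_ord_recl big_ord0 /fps_var /= mul0r add0r addr0 mul1r.
by rewrite subnn.
Qed.

Lemma H_mul_t : fps_mul H t =1 fps_var.
Proof.
case=> [|n]; first by rewrite /fps_mul big_ord1 /= t0 mulr0.
have sh0 : fps_shift t 0%N != 0 by rewrite /fps_shift t1 oner_neq0.
have := fps_mul_inv sh0 n; rewrite fps_mulC -/H => E.
rewrite /fps_mul big_ord_recr /= subnn t0 mulr0 addr0.
rewrite /fps_var eqSS -/(fps_one n) -E; apply: eq_bigr => i _.
by rewrite /fps_shift subSn // -ltnS.
Qed.

(* Main.v *)
Require Import Defs.
From HB Require Import structures.
From mathcomp Require Import all_boot all_order all_algebra.
From mathcomp Require Import boolp.
From mathcomp Require Import ring zify.

(* Write D = q d/dq. Since c_{pk} = c_k + chi(p) p^4 c_{k/p}, the number M_{m,p}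
   is congruent modulo p^4 to [q^m] C(q) H(q)^m, and the point is the exact
   identity B_m = [q^m] C H^m. As Dt/t = a^2 and C = a^2 b^3, where a and b are
   the cubic theta functions, that coefficient is the residue of
   b^3 dt / t^(m+1), so the identity says that b^3 = sum_k B_k t^k.
   With w = Db/b, the composite Y of 2F1(1/3,1/3;1;-27z) with t satisfies the
   equation D^2 Y - 2 w DY + 3 a b^3 t Y = 0, whose operator is (D - w)(D - w);
   hence DY = w Y and Y^3 = b^3.
   The differential relations between the Eisenstein series of level 3 used
   here are six convolution identities for divisor sums. All of them are
   instances of one identity for sums over the solutions of mn + m'n' = N, which
   comes from the substitution (m, n, m', n') -> (m - m', n, m', n + n'). *)

Set Implicit Arguments.
Unset Strict Implicit.
Unset Printing Implicit Defensive.

Import GRing.Theory Num.Theory.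

Local Open Scope ring_scope.

(** * The ring of formal power series *)

Lemma fpsP (f g : fps) : f =1 g -> f = g.
Proof. by move=> fg; apply/funext. Qed.

HB.instance Definition _ := gen_eqMixin fps.
HB.instance Definition _ := gen_choiceMixin fps.

Definition fps_add (f g : fps) : fps := fun n => f n + g n.
Definition fps_opp (f : fps) : fps := fun n => - f n.
Definition fps_zero : fps := fun=> 0.

Fact fps_addA : associative fps_add.
Proof. by move=> f g h; apply: fpsP => n; apply: addrA. Qed.
Fact fps_addC : commutative fps_add.
Proof. by move=> f g; apply: fpsP => n; apply: addrC. Qed.
Fact fps_add0 : left_id fps_zero fps_add.
Proof. by move=> f; apply: fpsP => n; apply: add0r. Qed.
Fact fps_addN : left_inverse fps_zero fps_opp fps_add.
Proof. by move=> f; apply: fpsP => n; apply: addNr. Qed.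

HB.instance Definition _ :=
  GRing.isZmodule.Build fps fps_addA fps_addC fps_add0 fps_addN.

Fact fps_mulC' : commutative fps_mul.
Proof. by move=> f g; apply: fpsP; apply: fps_mulC. Qed.

(** Truncation to a polynomial: coefficients up to degree [n] of a product only see the truncations,
    so associativity is inherited from [{poly rat}]. *)
Definition fps_poly (n : nat) (f : fps) : {poly rat} := \poly_(i < n.+1) f i.

Lemma coef_mul_fps_poly (f g : fps) (N n : nat) :
  (n <= N)%N -> (fps_poly N f * fps_poly N g)`_n = fps_mul f g n.
Proof.
move=> le_nN; rewrite coefM /fps_mul; apply: eq_bigr => i _.
rewrite !coef_poly !ltnS (leq_trans (leq_subr _ _) le_nN).
by rewrite (leq_trans _ le_nN) // -ltnS.
Qed.

Fact fps_mulA : associative fps_mul.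
Proof.
move=> f g h; apply: fpsP => n.
have -> : fps_mul f (fps_mul g h) n =
    (fps_poly n f * (fps_poly n g * fps_poly n h))`_n.
  rewrite coefM; apply: eq_bigr => i _.
  by rewrite coef_mul_fps_poly ?leq_subr // coef_poly ltn_ord.
rewrite mulrA coefM; apply: eq_bigr => i _.
by rewrite coef_mul_fps_poly -1?ltnS // coef_poly ltnS leq_subr.
Qed.

Fact fps_mul1 : left_id fps_one fps_mul.
Proof.
move=> f; apply: fpsP => n; rewrite /fps_mul big_ord_recl /= subn0 mul1r.
by rewrite big1 ?addr0 // => i _; rewrite mul0r.
Qed.

Fact fps_mulDl : left_distributive fps_mul fps_add.
Proof.
move=> f g h; apply: fpsP => n; rewrite /fps_mul /fps_add -big_split /=.
by apply: eq_bigr => i _; rewrite mulrDl.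
Qed.

Fact fps_oneNzero : fps_one != fps_zero.
Proof.
apply/eqP => /(congr1 (fun f : fps => f 0%N)).
by rewrite /fps_one /fps_zero /=; apply/eqP.
Qed.

HB.instance Definition _ := GRing.Zmodule_isComNzRing.Build fps
  fps_mulA fps_mulC' fps_mul1 fps_mulDl fps_oneNzero.

Lemma fpsDE (f g : fps) n : (f + g) n = f n + g n. Proof. by []. Qed.
Lemma fpsNE (f : fps) n : (- f) n = - f n. Proof. by []. Qed.
Lemma fpsBE (f g : fps) n : (f - g) n = f n - g n. Proof. by []. Qed.
Lemma fps1E n : (1 : fps) n = (n == 0%N)%:R. Proof. by []. Qed.
Lemma fps0E n : (0 : fps) n = 0. Proof. by []. Qed.
Lemma fpsME (f g : fps) n : (f * g) n = \sum_(i < n.+1) f i * g (n - i)%N.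
Proof. by []. Qed.
Lemma fpsM0 (f g : fps) : (f * g) 0%N = f 0%N * g 0%N.
Proof. by rewrite fpsME big_ord1. Qed.
Lemma fpsMnE (f : fps) k n : (f *+ k) n = f n *+ k.
Proof. by elim: k => // k IH; rewrite !mulrS fpsDE IH. Qed.
Lemma fps_natM k (f : fps) n : (k%:R * f) n = k%:R * f n.
Proof. by rewrite !mulr_natl fpsMnE. Qed.
Lemma fps_expE (f : fps) k : fps_exp f k = f ^+ k.
Proof. by elim: k => //= k IH; rewrite exprS -IH. Qed.
Lemma fps_sumE (I : Type) (r : seq I) (P : pred I) (F : I -> fps) n :
  (\sum_(i <- r | P i) F i) n = \sum_(i <- r | P i) F i n.
Proof. by elim/big_rec2: _ => // i y1 y2 _ <-. Qed.

Definition fps_D (f : fps) : fps := fun n => n%:R * f n.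

Lemma fps_DD f g : fps_D (f + g) = fps_D f + fps_D g.
Proof. by apply: fpsP => n; apply: mulrDr. Qed.
Lemma fps_DN f : fps_D (- f) = - fps_D f.
Proof. by apply: fpsP => n; apply: mulrN. Qed.
Lemma fps_D1 : fps_D 1 = 0.
Proof. by apply: fpsP => -[|n]; [apply: mul0r|apply: mulr0]. Qed.
Lemma fps_DM f g : fps_D (f * g) = fps_D f * g + f * fps_D g.
Proof.
apply: fpsP => n; rewrite fpsDE !fpsME /fps_D mulr_sumr -big_split /=.
apply: eq_bigr => i _.
have -> : n%:R = i%:R + (n - i)%:R :> rat by rewrite -natrD subnKC // -ltnS.
by ring.
Qed.
Lemma fps_DnatM k f : fps_D (k%:R * f) = k%:R * fps_D f.
Proof. by apply: fpsP => n; rewrite !fps_natM /fps_D fps_natM mulrCA. Qed.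
Lemma fps_DX f k : fps_D (f ^+ k.+1) = k.+1%:R * f ^+ k * fps_D f.
Proof.
elim: k => [|k IH]; first by rewrite expr0 expr1 mulr1 mul1r.
by rewrite exprS fps_DM IH (exprS f k) -[in RHS]natr1; ring.
Qed.

Lemma fps_mulIf (f g h : fps) : f 0%N != 0 -> f * g = f * h -> g = h.
Proof.
move=> f0 E.
have K : fps_inv f * f = 1.
  by rewrite mulrC; apply: fpsP; apply: fps_mul_inv.
by rewrite -[g]mul1r -[h]mul1r -K -!mulrA E.
Qed.

Lemma fps_natI k (f g : fps) : k.+1%:R * f = k.+1%:R * g -> f = g.
Proof.
move=> E; apply: fpsP => n; move/(congr1 (fun f : fps => f n)): E.
by rewrite !fps_natM => /mulfI -> //; rewrite pnatr_eq0.
Qed.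

(* The coefficient of q^n in [D y - c y] is [(n - c 0) y_n] plus terms in lower
   coefficients of [y]. *)
Lemma fps_ode0 (k : nat) (c y : fps) : c 0%N = k%:R -> fps_D y = c * y ->
  (y k = 0) -> y = 0.
Proof.
move=> c0 E yk; apply: fpsP; elim/ltn_ind => n IH; rewrite fps0E.
have [->//|ne_nk] := eqVneq n k.
have /(congr1 (fun f : fps => f n)) := E.
rewrite {1}/fps_D fpsME big_ord_recl subn0 c0 big1 ?addr0; last first.
  by move=> i _; rewrite IH ?mulr0 // lift0 ltn_subrL;
    apply: leq_ltn_trans (ltn_ord i).
move/eqP; rewrite -subr_eq0 -mulrBl mulf_eq0 subr_eq0 eqr_nat.
by rewrite (negPf ne_nk) => /eqP.
Qed.

(** Degree [k = c 0] is the only one in which the recursion leaves a coefficient free, so identities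
    between series reduce to a common logarithmic derivative and one coefficient. *)
Lemma fps_ode_unique (k : nat) (c y z : fps) : c 0%N = k%:R ->
  fps_D y = c * y -> fps_D z = c * z -> y k = z k -> y = z.
Proof.
move=> c0 Ey Ez yz; apply/eqP; rewrite -subr_eq0; apply/eqP.
apply: (fps_ode0 c0); last by rewrite fpsBE yz subrr.
by rewrite fps_DD fps_DN Ey Ez mulrBr.
Qed.

(** * Sums over the solutions of mn + m'n' = N *)

(** Sums over factorizations n = d e. Keeping both factors makes the class contain the derivatives
    of [lambert] series, since D multiplies by d e. The value at 0 is set apart because [divisors 0]
    is not empty. *)
Definition lambert2 (F : nat -> nat -> rat) : fps :=
  fun n => if n == 0%N then 0 else \sum_(d <- divisors n) F d (n %/ d)%N.

Definition lambert (phi : nat -> rat) : fps := lambert2 (fun d _ => phi d).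

Lemma sum_divisors_ord (N k : nat) (F : nat -> rat) : (0 < k <= N)%N ->
  \sum_(d <- divisors k) F d = \sum_(d < N.+1 | (0 < d)%N && (d %| k)%N) F d.
Proof.
case/andP=> k0 le_kN.
rewrite -(big_mkord (fun d => (0 < d)%N && (d %| k)%N) F) -[RHS]big_filter.
apply/perm_big/uniq_perm; rewrite ?divisors_uniq ?filter_uniq ?iota_uniq // => d.
rewrite mem_filter mem_index_iota -dvdn_divisors // ltnS.
case: (boolP (d %| k)%N) => [dk|]; last by rewrite andbF.
by rewrite (dvdn_gt0 k0 dk) /= (leq_trans (dvdn_leq k0 dk)).
Qed.

Lemma mulr_divn (k a b : nat) : (0 < b)%N -> (a * b)%N = k -> (k %/ b)%N = a.
Proof. by move=> b0 <-; rewrite mulnK. Qed.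

Section Solutions.
Variable N : nat.
Hypothesis N0 : (0 < N)%N.

(** A quadruple ((m, n), (m', n')). All entries of a solution are positive, so none exceeds [N]. *)
Let T4 := ('I_N.+1 * 'I_N.+1 * ('I_N.+1 * 'I_N.+1))%type.

Definition sol (x : T4) :=
  [&& (0 < x.1.1)%N, (0 < x.1.2)%N, (0 < x.2.1)%N, (0 < x.2.2)%N &
      (x.1.1 * x.1.2 + x.2.1 * x.2.2 == N)%N].

Lemma sol_swap (P : pred T4)
    (G : T4 -> rat) :
  \sum_(x | sol x && P x) G x =
  \sum_(x | sol x && P (x.2, x.1)) G (x.2, x.1).
Proof.
rewrite (reindex_onto (fun x => (x.2, x.1)) (fun x => (x.2, x.1))) /=;
  last by case.
apply: eq_bigl => -[[m n] [m' n']]; rewrite eqxx andbT; congr (_ && _).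
rewrite /sol /= addnC; do ![case: (0 < _)%N => //=].
Qed.

Lemma sol_sym (G : nat -> nat -> rat) :
  \sum_(x | sol x) G x.1.2 x.2.2 = \sum_(x | sol x) G x.2.2 x.1.2.
Proof.
have E (H : T4 -> rat) : \sum_(x | sol x) H x = \sum_(x | sol x && predT x) H x.
  by apply: eq_bigl => x; rewrite andbT.
by rewrite E sol_swap -E.
Qed.

(* The substitution [(m, n, m', n') -> (m - m', n, m', n + n')] preserves
   [m n + m' n']. *)
Lemma sol_shift (G : nat -> nat -> rat) :
  \sum_(x | sol x && (x.2.1 < x.1.1)%N) G x.1.2 x.2.2 =
  \sum_(x | sol x && (x.1.2 < x.2.2)%N) G x.1.2 (x.2.2 - x.1.2)%N.
Proof.
pose h (x : T4) :=
  ((inord (x.1.1 + x.2.1) : 'I_N.+1, x.1.2),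
   (x.2.1, inord (x.2.2 - x.1.2) : 'I_N.+1)).
pose h' (x : T4) :=
  ((inord (x.1.1 - x.2.1) : 'I_N.+1, x.1.2),
   (x.2.1, inord (x.1.2 + x.2.2) : 'I_N.+1)).
rewrite (reindex_onto h h') /=; last first.
  move=> [[m n] [m' n']] /= /andP[/and5P[/= m0 n0 m'0 n'0 /eqP E] lt].
  rewrite /h /h' /=.
  have le : (n + n' < N.+1)%N.
    by rewrite ltnS (leq_trans _ (eq_leq E)) // leq_add // leq_pmull.
  rewrite !inordK //; last by rewrite (leq_ltn_trans (leq_subr _ _)).
  by rewrite subnK ?(ltnW lt) // addKn !inord_val.
apply: eq_big => [[[m n] [m' n']]|[[m n] [m' n']]].
  rewrite /h /h' /=; apply/idP/idP.
    case/andP=> /andP[/and5P[/= m0 n0 m'0 n'0 /eqP E] lt] /eqP [Em En'].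
    have mlt := ltn_ord m.
    have n'E : (inord (n' - n) : 'I_N.+1) = (n' - n)%N :> nat.
      by rewrite inordK // (leq_ltn_trans (leq_subr _ _)).
    rewrite n'E in n'0 E En'.
    have lt' : (n < n')%N by rewrite -subn_gt0.
    rewrite lt' andbT /sol /= n0 m'0 (ltn_trans n0 lt') /=.
    (* Out of range [inord] returns 0, which contradicts the positivity of the first entry. *)
    have [le|gt] := leqP (m + m') N; last first.
      have : (N < m + m')%N by [].
      move: Em En'; rewrite subnKC ?(ltnW lt') // => Em En'.
      exfalso; move: m0 lt E.
      have -> : (inord (m + m') : 'I_N.+1) = 0%N :> nat.
        by rewrite /inord /insubd insubF //; apply/negbTE; rewrite -leqNgt.
      by [].
    rewrite inordK // in E lt.
    apply/andP; split; first by rewrite -(ltn_add2r m') add0n.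
    by apply/eqP; move: E; rewrite mulnDl -addnA -mulnDr subnKC // ltnW.
  case/andP=> /and5P[/= m0 n0 m'0 n'0 /eqP E] lt.
  have n'E : (inord (n' - n) : 'I_N.+1) = (n' - n)%N :> nat.
    by rewrite inordK // (leq_ltn_trans (leq_subr _ _)).
  have le : (m + m' < N.+1)%N.
    by rewrite ltnS (leq_trans _ (eq_leq E)) // leq_add // leq_pmulr.
  have E2 : ((m + m') * n + m' * (n' - n))%N = N.
    by rewrite mulnDl -addnA -mulnDr subnKC // ltnW.
  rewrite /sol /= n'E inordK // E2 addnK subnKC ?(ltnW lt) // !inord_val eqxx andbT.
  rewrite n0 m'0 addn_gt0 m0 eqxx /= andbT subn_gt0 lt /=.
  by rewrite -{1}[m' : nat]add0n ltn_add2r.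
by move=> _; rewrite inordK // (leq_ltn_trans (leq_subr _ _)).
Qed.

(** Split by comparing m with m'; [sol_shift] then carries the regions m' < m and m < m' to n < n'
    and n' < n. *)
Lemma sol_split (G : nat -> nat -> rat) :
  \sum_(x | sol x) G x.1.2 x.2.2 =
  \sum_(x | sol x && (x.1.1 == x.2.1)) G x.1.2 x.2.2 +
  \sum_(x | sol x && (x.1.2 < x.2.2)%N) G x.1.2 (x.2.2 - x.1.2)%N +
  \sum_(x | sol x && (x.2.2 < x.1.2)%N) G (x.1.2 - x.2.2)%N x.2.2.
Proof.
rewrite (bigID (fun x : T4 => x.1.1 == x.2.1)) /= -addrA; congr (_ + _).
rewrite (bigID (fun x : T4 => x.2.1 < x.1.1)%N) /=; congr (_ + _).
  rewrite -sol_shift; apply: eq_bigl => x; rewrite -andbA; congr (_ && _).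
  by case: ltnP => lt; rewrite ?andbF // andbT -val_eqE gtn_eqF.
transitivity (\sum_(x | sol x && (x.1.1 < x.2.1)%N) G x.1.2 x.2.2).
  apply: eq_bigl => x; rewrite -andbA; congr (_ && _).
  by rewrite -leqNgt -val_eqE ltn_neqAle.
by rewrite sol_swap /= (sol_shift (fun a b => G b a)) [RHS]sol_swap.
Qed.

Lemma sol_trichotomy (G : nat -> nat -> rat) :
  \sum_(x | sol x) G x.1.2 x.2.2 =
  \sum_(x | sol x && (x.1.2 == x.2.2)) G x.1.2 x.2.2 +
  \sum_(x | sol x && (x.1.2 < x.2.2)%N) G x.1.2 x.2.2 +
  \sum_(x | sol x && (x.2.2 < x.1.2)%N) G x.1.2 x.2.2.
Proof.
rewrite (bigID (fun x : T4 => x.1.2 == x.2.2)) /= -addrA; congr (_ + _).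
rewrite (bigID (fun x : T4 => x.1.2 < x.2.2)%N) /=; congr (_ + _).
  apply: eq_bigl => x; rewrite -andbA; congr (_ && _).
  by case: ltnP => lt; rewrite ?andbF // andbT -val_eqE ltn_eqF.
apply: eq_bigl => x; rewrite -andbA; congr (_ && _).
by rewrite -leqNgt -val_eqE eq_sym ltn_neqAle.
Qed.

(** The terms in (n, n'), (n - n', n) and (n, n - n') are split by comparing n with n', the other
    three by [sol_split]. All sums over n < n' then cancel in pairs, and only the diagonals n = n'
    and m = m' survive. *)
Lemma sol_identity (f : int -> int -> rat) :
    (forall i j, f (- i) (- j) = f i j) ->
  \sum_(x | sol x) (f x.1.2 x.2.2 - f x.1.2 (- x.2.2%:Z)
     - f (x.1.2%:Z + x.2.2%:Z) x.1.2 + f (x.1.2%:Z - x.2.2%:Z) x.1.2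
     - f x.1.2 (x.1.2%:Z + x.2.2%:Z) + f x.1.2 (x.1.2%:Z - x.2.2%:Z)) =
  \sum_(x | sol x && (x.1.2 == x.2.2))
     (f x.1.2 x.1.2 + f 0 x.1.2 + f x.1.2 0) -
  \sum_(x | sol x && (x.1.1 == x.2.1))
     (f (x.1.2 + x.2.2)%N x.1.2 + f x.1.2 (x.1.2 + x.2.2)%N
      + f x.1.2 (- x.2.2%:Z)).
Proof.
move=> fN.
pose L G := \sum_(x | sol x && (x.1.2 < x.2.2)%N) G x.1.2 x.2.2 : rat.
pose D G := \sum_(x | sol x && (x.1.2 == x.2.2)) G x.1.2 x.2.2 : rat.
pose S G := \sum_(x | sol x && (x.1.1 == x.2.1)) G x.1.2 x.2.2 : rat.
have eqL (G1 G2 : nat -> nat -> rat) :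
    (forall n n', (n < n')%N -> G1 n n' = G2 n n') -> L G1 = L G2.
  by move=> E; apply: eq_bigr => x /andP[_ lt]; apply: E.
have tri (G : nat -> nat -> rat) : \sum_(x | sol x) G x.1.2 x.2.2 =
    D G + L G + L (fun n n' => G n' n).
  by rewrite sol_trichotomy; congr (_ + _); rewrite sol_swap.
have spl (G : nat -> nat -> rat) : \sum_(x | sol x) G x.1.2 x.2.2 =
    S G + L (fun n n' => G n (n' - n)%N) + L (fun n n' => G (n' - n)%N n).
  by rewrite sol_split; congr (_ + _); rewrite sol_swap.
rewrite !(big_split, sumrN) /= -/(D (fun n n' => f n n)).
rewrite (tri (fun n n' => f n n')).
rewrite (tri (fun n n' => f (n%:Z - n'%:Z) n)).
rewrite (tri (fun n n' => f n (n%:Z - n'%:Z))).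
rewrite (spl (fun n n' => f n (- n'%:Z))).
rewrite (spl (fun n n' => f (n%:Z + n'%:Z) n)).
rewrite (spl (fun n n' => f n (n%:Z + n'%:Z))).
rewrite (eqL (fun n n' => f n (- (n' - n)%N%:Z))
             (fun n n' => f n (n%:Z - n'%:Z)));
  last by move=> n n' lt; congr f; lia.
(* Evenness of [f] enters here, exchanging (n' - n, -n) for (n - n', n). *)
rewrite (eqL (fun n n' => f (n' - n)%N (- n%:Z))
             (fun n n' => f (n%:Z - n'%:Z) n));
  last by move=> n n' lt; rewrite -fN; congr f; lia.
rewrite (eqL (fun n n' => f (n%:Z + (n' - n)%N%:Z) n) (fun n n' => f n' n));
  last by move=> n n' lt; congr f; lia.
rewrite (eqL (fun n n' => f ((n' - n)%N%:Z + n%:Z) (n' - n)%N)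
             (fun n n' => f n' (n'%:Z - n%:Z)));
  last by move=> n n' lt; congr f; lia.
rewrite (eqL (fun n n' => f n (n%:Z + (n' - n)%N%:Z)) (fun n n' => f n n'));
  last by move=> n n' lt; congr f; lia.
rewrite (eqL (fun n n' => f (n' - n)%N ((n' - n)%N%:Z + n%:Z))
             (fun n n' => f (n'%:Z - n%:Z) n'));
  last by move=> n n' lt; congr f; lia.
have -> : D (fun n n' => f (n%:Z - n'%:Z) n) = D (fun n n' => f 0 n).
  by apply: eq_bigr => x /andP[_ /eqP ->]; rewrite subrr.
have -> : D (fun n n' => f n (n%:Z - n'%:Z)) = D (fun n n' => f n 0).
  by apply: eq_bigr => x /andP[_ /eqP ->]; rewrite subrr.
have -> : D (fun n n' => f n n') = D (fun n n' => f n n).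
  by apply: eq_bigr => x /andP[_ /eqP ->].
by rewrite /D /S /=; ring.
Qed.

(** For n = n' = d the equation becomes m + m' = N/d, with N/d - 1 positive solutions. *)
Lemma sol_diag_n (X : nat -> rat) :
  \sum_(x | sol x && (x.1.2 == x.2.2)) X x.1.2 =
  \sum_(d <- divisors N) ((N %/ d)%:R - 1) * X d.
Proof.
pose h (y : 'I_N.+1 * 'I_N.+1) :=
  ((y.2, y.1), (inord (N %/ y.1 - y.2) : 'I_N.+1, y.1)).
pose h' (x : T4) := (x.1.2, x.1.1).
rewrite (reindex_onto h h') /=; last first.
  move=> [[m n] [m' n']] /andP[/and5P[/= m0 n0 m'0 n'0 /eqP E] /eqP /= En].
  subst n'; rewrite /h /h' /=; congr (_, (_, _)); apply: val_inj => /=.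
  have -> : (N %/ n = m + m')%N by apply: mulr_divn; rewrite // mulnDl.
  by rewrite addKn inordK.
rewrite (sum_divisors_ord _ (k := N) (N := N)) ?N0 ?leqnn //.
transitivity (\sum_(y : 'I_N.+1 * 'I_N.+1 |
    ((0 < y.1)%N && (y.1 %| N)%N) && (0 < y.2 < N %/ y.1)%N) X y.1).
  apply: eq_bigl => -[d k]; rewrite /h /h' /= !eqxx !andbT.
  have lt : (N %/ d - k < N.+1)%N by rewrite ltnS (leq_trans (leq_subr _ _)) ?leq_div.
  rewrite /sol /= inordK //.
  case d0: (0 < d)%N; rewrite ?andbF //= subn_gt0.
  case k0: (0 < k)%N; rewrite ?andbF //=.
  case lt': (k < N %/ d)%N; rewrite ?andbF //= andbT.
  by rewrite -mulnDl subnKC ?(ltnW lt') // dvdn_eq.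
rewrite -(pair_big_dep (fun d : 'I_N.+1 => (0 < d)%N && (d %| N)%N)
  (fun d k : 'I_N.+1 => (0 < k < N %/ d)%N) (fun d _ => X d)) /=.
apply: eq_bigr => d /andP[d0 dN]; rewrite sumr_const -[LHS]mulr_natl; congr (_ * _).
have q0 : (0 < N %/ d)%N by rewrite divn_gt0 // dvdn_leq.
rewrite -[1](mulr1n 1) -natrB //; congr _%:R.
rewrite -sum1_card (eq_bigl (fun k : 'I_N.+1 => 0 < k < N %/ d)%N) //.
rewrite -(big_mkord (fun k => 0 < k < N %/ d)%N (fun=> 1%N)) sum1_count.
rewrite (@eq_count _ _ (fun k => k \in index_iota 1 (N %/ d))); last first.
  by move=> k; rewrite mem_index_iota.
rewrite -size_filter -(size_iota 1 (N %/ d - 1)).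
apply/perm_size/uniq_perm; rewrite ?filter_uniq ?iota_uniq // => k.
rewrite mem_filter mem_index_iota /= andb_idr // mem_index_iota => /andP[_ lt].
by rewrite ltnS (leq_trans (ltnW lt)) // leq_div.
Qed.

(** For m = m' the equation becomes m (n + n') = N, so d = n + n' is a divisor of [N] and determines
    m. *)
Lemma sol_diag_m (Y : nat -> nat -> rat) :
  \sum_(x | sol x && (x.1.1 == x.2.1)) Y x.1.2 x.2.2 =
  \sum_(d <- divisors N) \sum_(1 <= k < d) Y k (d - k)%N.
Proof.
pose h (y : 'I_N.+1 * 'I_N.+1) :=
  ((inord (N %/ y.1) : 'I_N.+1, y.2),
   (inord (N %/ y.1) : 'I_N.+1, inord (y.1 - y.2) : 'I_N.+1)).
pose h' (x : T4) :=
  (inord (x.1.2 + x.2.2) : 'I_N.+1, x.1.2).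
rewrite (reindex_onto h h') /=; last first.
  move=> [[m n] [m' n']] /andP[/and5P[/= m0 n0 m'0 n'0 /eqP E] /eqP /= Em].
  move: E; rewrite /h /h' /= -Em => E.
  have le : (n + n' < N.+1)%N.
    by rewrite ltnS (leq_trans _ (eq_leq E)) // -mulnDr leq_pmull.
  rewrite inordK // addKn inord_val.
  have -> : (N %/ (n + n') = m)%N by apply: mulr_divn; rewrite ?addn_gt0 ?n0 // mulnDr.
  by rewrite inord_val.
rewrite (sum_divisors_ord _ (k := N) (N := N)) ?N0 ?leqnn //.
transitivity (\sum_(y : 'I_N.+1 * 'I_N.+1 |
    ((0 < y.1)%N && (y.1 %| N)%N) && (0 < y.2 < y.1)%N) Y y.2 (y.1 - y.2)%N).
  apply: eq_big => -[d k]; rewrite /h /h' /= ?eqxx ?andbT; last first.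
    by rewrite inordK // (leq_ltn_trans (leq_subr _ _)).
  have lt : (N %/ d < N.+1)%N by rewrite ltnS leq_div.
  have lt2 : (d - k < N.+1)%N by rewrite (leq_ltn_trans (leq_subr _ _)).
  rewrite /sol /= !inordK // subn_gt0.
  case k0: (0 < k)%N; rewrite ?andbF //=.
  case lt': (k < d)%N; rewrite ?andbF //= ?andbT.
  have d0 : (0 < d)%N by rewrite (leq_trans _ lt').
  rewrite subnKC ?(ltnW lt') // inord_val eqxx andbT -mulnDr subnKC ?(ltnW lt') //.
  rewrite d0 /= -dvdn_eq; case dN: (d %| N)%N; rewrite ?andbF // andbT.
  by rewrite divn_gt0 // dvdn_leq.
rewrite -(pair_big_dep (fun d : 'I_N.+1 => (0 < d)%N && (d %| N)%N)
  (fun d k : 'I_N.+1 => (0 < k < d)%N) (fun d k : 'I_N.+1 => Y k (d - k)%N)) /=.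
apply: eq_bigr => d /andP[d0 dN].
rewrite -(big_mkord (fun k => 0 < k < d)%N (fun k => Y k (d - k)%N)) -big_filter.
apply/perm_big/uniq_perm; rewrite ?filter_uniq ?iota_uniq // => k.
rewrite mem_filter !mem_index_iota /= andb_idr // => /andP[_ lt].
by rewrite (ltn_trans lt).
Qed.

Lemma lambert_mul (phi psi : nat -> rat) :
  (lambert phi * lambert psi) N = \sum_(x | sol x) phi x.1.2 * psi x.2.2.
Proof.
pose T := ('I_N.+1 * 'I_N.+1)%type.
pose r (x : T) k := [&& (0 < x.1)%N, (0 < x.2)%N & (x.1 * x.2 == k)%N].
have lE (F : nat -> rat) k : (k <= N)%N ->
    lambert F k = \sum_(x : T | r x k) F x.2.
  case: k => [_|k lt].
    rewrite /lambert /lambert2 eqxx big1 // => x /and3P[x1 x2].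
    by rewrite -leqn0 leqNgt muln_gt0 x1 x2.
  rewrite /lambert /lambert2 /= (sum_divisors_ord _ (N := N)) //.
  rewrite [RHS](reindex_onto
    (fun d : 'I_N.+1 => (inord (k.+1 %/ d) : 'I_N.+1, d)) (fun x : T => x.2)) /=.
    apply: eq_bigl => d; rewrite eqxx andbT /r /=.
    have lt' : (k.+1 %/ d < N.+1)%N.
      by rewrite (leq_ltn_trans (leq_div _ _)).
    rewrite inordK // -dvdn_eq; case d0: (0 < d)%N; rewrite ?andbF //=.
    by rewrite andb_idl // => dk; rewrite divn_gt0 // dvdn_leq.
  move=> [m n] /and3P[/= m0 n0 /eqP E]; congr (_, _); apply: val_inj.
  by rewrite /= -E mulnK // inordK.
rewrite fpsME.
transitivity (\sum_(i < N.+1) \sum_(x : T | r x i) \sum_(y : T | r y (N - i)%N)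
    phi x.2 * psi y.2).
  apply: eq_bigr => i _; rewrite !lE ?leq_subr -1?ltnS // mulr_suml.
  by apply: eq_bigr => x _; rewrite mulr_sumr.
under eq_bigr => i _ do rewrite pair_big_dep /=.
rewrite (exchange_big_dep predT) //=.
rewrite [RHS]big_mkcond; apply: eq_bigr => -[x y] _ /=.
(* After the exchange of sums the Cauchy index is forced to be m n; if m n exceeds [N], both sides
   vanish. *)
rewrite /sol /r /=; have [lt|gt] := ltnP (x.1 * x.2) N.+1.
  rewrite (eq_bigl (fun i => [&& (0 < x.1)%N, (0 < x.2)%N, (0 < y.1)%N,
    (0 < y.2)%N & (x.1 * x.2 + y.1 * y.2 == N)%N] && (i == Ordinal lt))); last first.
    move=> i; rewrite -val_eqE /= [(i : nat) == _]eq_sym.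
    do 4 case: (0 < _)%N; rewrite ?andbF //=.
    case: (eqVneq (x.1 * x.2)%N i) => [E|]; rewrite ?andbF // andbT /=.
    by rewrite -(eqn_add2l (x.1 * x.2)) {2}E subnKC // -ltnS.
  case: ifP => c; first by rewrite (big_pred1 (Ordinal lt)).
  by rewrite big_pred0.
rewrite big1 => [|i]; last first.
  case/andP=> /and3P[_ _ /eqP E]; move: (ltn_ord i); rewrite -E => lt.
  by rewrite ltnNge gt in lt.
case: ifP => // /and5P[_ _ _ _ /eqP E].
by move: gt; rewrite ltnNge -[leqRHS]E leq_addr.
Qed.
End Solutions.

(** * Convolution identities of level 3 *)

Lemma lambertE phi : lambert phi = lambert2 (fun d _ => phi d).
Proof. by []. Qed.

Lemma lambert2D F G :
  lambert2 F + lambert2 G = lambert2 (fun d e => F d e + G d e).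
Proof.
apply: fpsP => n; rewrite fpsDE /lambert2.
by case: eqP => _; rewrite ?addr0 // big_split.
Qed.

Lemma lambert2_natM k F :
  k%:R * lambert2 F = lambert2 (fun d e => k%:R * F d e).
Proof.
apply: fpsP => n; rewrite fps_natM /lambert2.
by case: eqP => _; rewrite ?mulr0 // mulr_sumr.
Qed.

Lemma lambert2N F : - lambert2 F = lambert2 (fun d e => - F d e).
Proof.
apply: fpsP => n; rewrite fpsNE /lambert2.
by case: eqP => _; rewrite ?oppr0 // sumrN.
Qed.

Lemma fps_D_lambert phi :
  fps_D (lambert phi) = lambert2 (fun d e => e%:R * d%:R * phi d).
Proof.
apply: fpsP => n; rewrite /fps_D /lambert /lambert2.
case: eqP => [|/eqP n0]; rewrite ?mulr0 // mulr_sumr.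
apply: eq_big_seq => d; rewrite -dvdn_divisors ?lt0n // => dn.
by rewrite -natrM divnK.
Qed.

Lemma fps_intM (k : int) (f : fps) n : (k%:~R * f) n = k%:~R * f n.
Proof.
case: k => k; first exact: fps_natM.
by rewrite NegzE !mulrNz !mulNr fpsNE fps_natM.
Qed.

Definition quad (f : int -> int -> rat) (i j : int) : rat :=
  f i j - f i (- j) - f (i + j) i + f (i - j) i - f i (i + j) + f i (i - j).

(* [G d] is an antidifference in [k] of [f d k + f k d + f k (k - d)], the summand
   of the boundary term. *)
Lemma lambert_convolution (f G : int -> int -> rat) (x1 x2 : rat)
    (a1 b1 a2 b2 : nat -> rat) (y1 y2 : int) (r : rat) (F : nat -> nat -> rat) :
    (forall i j, f (- i) (- j) = f i j) ->
    (forall i j, f i j + f j i + f j (j - i) = G i (j + 1) - G i j) ->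
    (forall n n' : nat, quad f n n' + quad f n' n =
       x1 * (a1 n * b1 n' + a1 n' * b1 n) + x2 * (a2 n * b2 n' + a2 n' * b2 n)) ->
    y1%:~R = r * x1 -> y2%:~R = r * x2 ->
    (forall d e : nat, F d e =
      r * ((e%:R - 1) * (f d d + f 0 d + f d 0) - (G d d - G d 1))) ->
  y1%:~R * (lambert a1 * lambert b1) + y2%:~R * (lambert a2 * lambert b2) =
  lambert2 F.
Proof.
move=> fN fG quadE y1E y2E FE.
suff H N : x1 * (lambert a1 * lambert b1) N + x2 * (lambert a2 * lambert b2) N =
    lambert2 (fun d e => (e%:R - 1) * (f d d + f 0 d + f d 0) - (G d d - G d 1)) N.
  apply: fpsP => N; rewrite fpsDE !fps_intM y1E y2E -!mulrA -mulrDr H /lambert2.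
  case: eqP => _; rewrite ?mulr0 // mulr_sumr; apply: eq_bigr => d _.
  by rewrite FE.
case: N => [|N].
  by rewrite !fpsM0 /lambert /lambert2 eqxx !mul0r !mulr0 addr0.
have N0 : (0 < N.+1)%N by [].
rewrite /lambert2 /= sumrB -(sol_diag_n N0 (fun d => f d d + f 0 d + f d 0)).
(* On the boundary m = m', with n = k and n + n' = d, the summand is a difference of [G d], and the
   sum over k telescopes. *)
have -> : \sum_(d <- divisors N.+1) (G d d - G d 1) =
    \sum_(x : 'I_N.+2 * 'I_N.+2 * ('I_N.+2 * 'I_N.+2) | sol x && (x.1.1 == x.2.1))
     (f (x.1.2 + x.2.2)%N x.1.2 + f x.1.2 (x.1.2 + x.2.2)%N
      + f x.1.2 (- x.2.2%:Z)).
  rewrite (sol_diag_m N0 (fun k l => f (k + l)%N k + f k (k + l)%N + f k (- l%:Z))).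
  apply: eq_big_seq => d; rewrite -dvdn_divisors // => /dvdn_gt0 d0.
  rewrite -(telescope_sumr (fun k : nat => G d k)) ?d0 //.
  rewrite !big_nat; apply: eq_bigr => k /andP[_ lt].
  by rewrite subnKC ?(ltnW lt) // -addn1 PoszD -fG; congr (_ + f _ _); lia.
rewrite -sol_identity //.
pose T G := \sum_(x | @sol N.+1 x) G x.1.2 x.2.2 : rat.
have symT (K : nat -> nat -> rat) : T K = T (fun n n' => K n' n) by exact: sol_sym.
have lT a b : (lambert a * lambert b) N.+1 = T (fun n n' => a n * b n').
  by rewrite lambert_mul.
have TD K1 K2 : T (fun n n' => K1 n n' + K2 n n') = T K1 + T K2.
  by rewrite /T big_split.
have TM x K : T (fun n n' => x * K n n') = x * T K by rewrite /T mulr_sumr.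
transitivity (T (fun n n' => quad f n n')); last by [].
(* Only the symmetrization of [quad] is known, so both sides are doubled and n, n' are exchanged in
   one copy. *)
have two : (2 : rat) != 0 by [].
apply: (mulfI two); rewrite 2!mulr_natl !mulr2n.
have -> : T (fun n n' => quad f n n') + T (fun n n' => quad f n n') =
    T (fun n n' => quad f n n' + quad f n' n).
  rewrite (TD (fun n n' => quad f n n') (fun n n' => quad f n' n)).
  by congr (_ + _); exact: (symT (fun n n' => quad f n n')).
transitivity (T (fun n n' => x1 * (a1 n * b1 n' + a1 n' * b1 n) +
    x2 * (a2 n * b2 n' + a2 n' * b2 n))); last first.
  by apply: eq_bigr => x _; rewrite quadE.
rewrite TD !TM !TD !lT.
have -> : T (fun n n' => a1 n' * b1 n) = T (fun n n' => a1 n * b1 n').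
  exact: (symT (fun n n' => a1 n' * b1 n)).
have -> : T (fun n n' => a2 n' * b2 n) = T (fun n n' => a2 n * b2 n').
  exact: (symT (fun n n' => a2 n' * b2 n)).
by ring.
Qed.

(** With x = 2 pi z / 3, [eps z] is 2 cos x and [chi z] is (2 / sqrt 3) sin x, where [chi] is the
    nontrivial character modulo 3. The lemmas [chiD] and [epsD] are the addition formulas of sine
    and cosine. *)
Definition chi (z : int) : rat :=
  if (z %% 3)%Z == 1 then 1 else if (z %% 3)%Z == 2 then -1 else 0.

Definition eps (z : int) : rat := if (z %% 3)%Z == 0 then 2 else -1.

Lemma chi_eps_mod z : [\/ [/\ (z %% 3)%Z = 0, chi z = 0 & eps z = 2],
  [/\ (z %% 3)%Z = 1, chi z = 1 & eps z = -1] |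
  [/\ (z %% 3)%Z = 2, chi z = -1 & eps z = -1]].
Proof.
rewrite /chi /eps; have := ltz_pmod z (isT : 0 < 3 :> int).
have := modz_ge0 z (isT : 3 != 0 :> int).
case: (z %% 3)%Z => // -[|[|[|k]]] //= _ _.
- by constructor 1.
- by constructor 2.
- by constructor 3.
Qed.

Lemma chi_epsD x y : chi (x + y) = (chi x * eps y + eps x * chi y) / 2 /\
  eps (x + y) = (eps x * eps y - 3 * chi x * chi y) / 2.
Proof.
rewrite {1}/chi {3}/eps -modzDm.
by case: (chi_eps_mod x) => -[-> -> ->]; case: (chi_eps_mod y) => -[-> -> ->].
Qed.

Lemma chiD x y : chi (x + y) = (chi x * eps y + eps x * chi y) / 2.
Proof. by case: (chi_epsD x y). Qed.

Lemma epsD x y : eps (x + y) = (eps x * eps y - 3 * chi x * chi y) / 2.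
Proof. by case: (chi_epsD x y). Qed.

Lemma chi_epsN x : chi (- x) = - chi x /\ eps (- x) = eps x.
Proof.
rewrite {1}/chi {1}/eps -modzNm.
by case: (chi_eps_mod x) => -[-> -> ->].
Qed.

Lemma chiN x : chi (- x) = - chi x. Proof. by case: (chi_epsN x). Qed.
Lemma epsN x : eps (- x) = eps x. Proof. by case: (chi_epsN x). Qed.
Lemma chi1 : chi 1 = 1. Proof. by []. Qed.
Lemma eps1 : eps 1 = -1. Proof. by []. Qed.
Lemma chi0 : chi 0 = 0. Proof. by []. Qed.
Lemma eps0 : eps 0 = 2. Proof. by []. Qed.

Definition chi_epsE :=
  (chiN, epsN, chiD, epsD, chi1, eps1, chi0, eps0, intrD, intrM, rmorphN).

(** The parity rule makes [pw k] odd in n. The series [LA k] belongs to weight k + 1: odd weights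
    carry the character [chi], even weights the trivial one, where [eps] combines the divisor sums
    at n and at n / 3. *)
Definition pw (k n : nat) : rat := n%:R ^+ k * (if odd k then eps n else chi n).

Definition LA (k : nat) : fps := lambert (pw k).

Ltac chi_cases z := case: (chi_eps_mod z) => -[_ -> ->].



(** This and the next five lemmas are instances of [lambert_convolution]. The test function [f] is a
    monomial times [chi] or [eps] of i + j, or a function of i - j; the addition formulas turn its
    [quad] into products of values of [pw]. When a single product occurs, the second slot holds zero
    series. *)
Lemma conv_LA0_LA0 :
  3 * LA 0 ^+ 2 = - lambert2 (fun d e => e%:R * eps d) - LA 0.
Proof.
pose f (i j : int) := eps (i + j) : rat.
(* As 2k - d = -(k + d) modulo 3, all three summands equal [eps (k + d)], and 3/2 ([chi] - [eps]) is
   an antidifference of 3 [eps]. *)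
pose G (d k : int) := (3 / 2) * chi (k + d) - (3 / 2) * eps (k + d) : rat.
have fN i j : f (- i) (- j) = f i j by rewrite /f !chi_epsE; ring.
have fG i j : f i j + f j i + f j (j - i) = G i (j + 1) - G i j.
  by rewrite /f /G !chi_epsE; chi_cases i; chi_cases j; field.
have fQ (n n' : nat) : quad f n n' + quad f n' n =
    (-9) * ((pw 0) n * (pw 0) n' + (pw 0) n' * (pw 0) n) +
    0 * ((fun=> 0) n * (fun=> 0) n' + (fun=> 0) n' * (fun=> 0) n).
  by rewrite /quad /f /pw /= !chi_epsE; chi_cases n; chi_cases n'; field.
transitivity (3%:~R * (LA 0 * LA 0)
  + 0%:~R * (lambert (fun=> 0) * lambert (fun=> 0))).
  by ring.
rewrite /LA ?fps_D_lambert !(lambertE, lambert2_natM, lambert2N, lambert2D).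
apply: (lambert_convolution (r := (- 3^-1)) fN fG fQ) => //= d e.
by rewrite /f /G /pw /= !chi_epsE; chi_cases d; field.
Qed.

Lemma conv_LA0_LA1 :
  6 * (LA 0 * LA 1) =
  2 * LA 0 - LA 1 + 3 * LA 2 - 6 * fps_D (LA 0).
Proof.
pose f (i j : int) := (i - j)%:~R * chi (i - j) : rat.
(* Since k - (k - d) = d, the third summand is constant in k and gives the last term; the other two
   agree by evenness. *)
pose G (d k : int) := (2 / 3 - (k%:~R - d%:~R)) * chi (k - d) -
  3^-1 * (k%:~R - d%:~R) * eps (k - d) + k%:~R * d%:~R * chi d : rat.
have fN i j : f (- i) (- j) = f i j by rewrite /f !chi_epsE; ring.
have fG i j : f i j + f j i + f j (j - i) = G i (j + 1) - G i j.
  by rewrite /f /G !chi_epsE; chi_cases i; chi_cases j; field.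
have fQ (n n' : nat) : quad f n n' + quad f n' n =
    (-2) * ((pw 0) n * (pw 1) n' + (pw 0) n' * (pw 1) n) +
    0 * ((fun=> 0) n * (fun=> 0) n' + (fun=> 0) n' * (fun=> 0) n).
  by rewrite /quad /f /pw /= !chi_epsE; chi_cases n; chi_cases n'; field.
transitivity (6%:~R * (LA 0 * LA 1)
  + 0%:~R * (lambert (fun=> 0) * lambert (fun=> 0))).
  by ring.
rewrite /LA ?fps_D_lambert !(lambertE, lambert2_natM, lambert2N, lambert2D).
apply: (lambert_convolution (r := (-3)) fN fG fQ) => //= d e.
by rewrite /f /G /pw /= !chi_epsE; chi_cases d; field.
Qed.

(** In weights 4 and 5 two products share the weight, and two test functions give two relations. One
    serves as a differential equation; eliminating the derivative between the two gives an algebraic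
    relation. *)
Lemma conv_LA1_LA1_LA0_LA2 :
  3 * LA 1 ^+ 2 + 18 * (LA 0 * LA 2) =
  2 * LA 1 + 2 * LA 0 - 3 * LA 2 - 3 * fps_D (LA 1).
Proof.
pose f (i j : int) := i%:~R * j%:~R * eps (i + j) : rat.
pose G (d k : int) := (k%:~R ^+ 2 / 2 + k%:~R * d%:~R / 2 - 3^-1) * chi (k + d) +
  (- (k%:~R ^+ 2 / 2) - k%:~R * d%:~R / 2 + 2 / 3 * k%:~R +
   d%:~R / 3) * eps (k + d) : rat.
have fN i j : f (- i) (- j) = f i j by rewrite /f !chi_epsE; ring.
have fG i j : f i j + f j i + f j (j - i) = G i (j + 1) - G i j.
  by rewrite /f /G !chi_epsE; chi_cases i; chi_cases j; field.
have fQ (n n' : nat) : quad f n n' + quad f n' n =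
    (-1) * ((pw 1) n * (pw 1) n' + (pw 1) n' * (pw 1) n) +
    (-6) * ((pw 0) n * (pw 2) n' + (pw 0) n' * (pw 2) n).
  by rewrite /quad /f /pw /= !chi_epsE; chi_cases n; chi_cases n'; field.
transitivity (3%:~R * (LA 1 * LA 1) + 18%:~R * (LA 0 * LA 2)).
  by ring.
rewrite /LA ?fps_D_lambert !(lambertE, lambert2_natM, lambert2N, lambert2D).
apply: (lambert_convolution (r := (-3)) fN fG fQ) => //= d e.
by rewrite /f /G /pw /= !chi_epsE; chi_cases d; field.
Qed.

Lemma conv_LA1_LA1_LA0_LA2' :
  6 * LA 1 ^+ 2 - 18 * (LA 0 * LA 2) =
  4 * LA 1 - 2 * LA 0 + 3 * LA 2 + 3 * LA 3 - 6 * fps_D (LA 1).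
Proof.
pose f (i j : int) := (i - j)%:~R ^+ 2 * eps (i - j) : rat.
pose G (d k : int) :=
  ((k%:~R - d%:~R) ^+ 2 - 2 / 3) * chi (k - d) +
  (4 / 3 * (k%:~R - d%:~R) - (k%:~R - d%:~R) ^+ 2) * eps (k - d) +
  k%:~R * (d%:~R ^+ 2 * eps d) : rat.
have fN i j : f (- i) (- j) = f i j by rewrite /f !chi_epsE; ring.
have fG i j : f i j + f j i + f j (j - i) = G i (j + 1) - G i j.
  by rewrite /f /G !chi_epsE; chi_cases i; chi_cases j; field.
have fQ (n n' : nat) : quad f n n' + quad f n' n =
    (-2) * ((pw 1) n * (pw 1) n' + (pw 1) n' * (pw 1) n) +
    6 * ((pw 0) n * (pw 2) n' + (pw 0) n' * (pw 2) n).
  by rewrite /quad /f /pw /= !chi_epsE; chi_cases n; chi_cases n'; field.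
transitivity (6%:~R * (LA 1 * LA 1) + (-18)%:~R * (LA 0 * LA 2)).
  by ring.
rewrite /LA ?fps_D_lambert !(lambertE, lambert2_natM, lambert2N, lambert2D).
apply: (lambert_convolution (r := (-3)) fN fG fQ) => //= d e.
by rewrite /f /G /pw /= !chi_epsE; chi_cases d; field.
Qed.

Lemma conv_LA1_LA2_LA0_LA3 :
  9 * (LA 1 * LA 2) - 6 * (LA 0 * LA 3) =
  LA 1 + 3 * LA 2 + 2 * LA 0 + LA 3 - 3 * fps_D (LA 2).
Proof.
pose f (i j : int) := i%:~R ^+ 2 * j%:~R * chi (i + j) : rat.
pose G (d k : int) :=
  (k%:~R ^+ 3 / 2 - k%:~R ^+ 2 * d%:~R - k%:~R ^+ 2 - k%:~R * d%:~R ^+ 2 / 2 +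
   4 / 3 * k%:~R * d%:~R + d%:~R ^+ 2 / 3 + 3^-1) * chi (k + d) +
  (k%:~R ^+ 3 / 6 - k%:~R ^+ 2 * d%:~R / 3 - k%:~R * d%:~R ^+ 2 / 6 - k%:~R / 3 +
   2 / 9 * d%:~R) * eps (k + d) : rat.
have fN i j : f (- i) (- j) = f i j by rewrite /f !chi_epsE; ring.
have fG i j : f i j + f j i + f j (j - i) = G i (j + 1) - G i j.
  by rewrite /f /G !chi_epsE; chi_cases i; chi_cases j; field.
have fQ (n n' : nat) : quad f n n' + quad f n' n =
    3 * ((pw 1) n * (pw 2) n' + (pw 1) n' * (pw 2) n) +
    (-2) * ((pw 0) n * (pw 3) n' + (pw 0) n' * (pw 3) n).
  by rewrite /quad /f /pw /= !chi_epsE; chi_cases n; chi_cases n'; field.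
transitivity (9%:~R * (LA 1 * LA 2) + (-6)%:~R * (LA 0 * LA 3)).
  by ring.
rewrite /LA ?fps_D_lambert !(lambertE, lambert2_natM, lambert2N, lambert2D).
apply: (lambert_convolution (r := 3) fN fG fQ) => //= d e.
by rewrite /f /G /pw /= !chi_epsE; chi_cases d; field.
Qed.

Lemma conv_LA1_LA2_LA0_LA3' :
  18 * (LA 1 * LA 2) + 6 * (LA 0 * LA 3) =
  3 * LA 4 + 2 * LA 1 + 6 * LA 2 - 2 * LA 0 - LA 3 - 6 * fps_D (LA 2).
Proof.
pose f (i j : int) := (i - j)%:~R ^+ 3 * chi (i - j) : rat.
pose G (d k : int) :=
  (2 * (k%:~R - d%:~R) ^+ 2 - (k%:~R - d%:~R) ^+ 3 - 2 / 3) * chi (k - d) +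
  (2 / 3 * (k%:~R - d%:~R) - (k%:~R - d%:~R) ^+ 3 / 3) * eps (k - d) +
  k%:~R * (d%:~R ^+ 3 * chi d) : rat.
have fN i j : f (- i) (- j) = f i j by rewrite /f !chi_epsE; ring.
have fG i j : f i j + f j i + f j (j - i) = G i (j + 1) - G i j.
  by rewrite /f /G !chi_epsE; chi_cases i; chi_cases j; field.
have fQ (n n' : nat) : quad f n n' + quad f n' n =
    (-6) * ((pw 1) n * (pw 2) n' + (pw 1) n' * (pw 2) n) +
    (-2) * ((pw 0) n * (pw 3) n' + (pw 0) n' * (pw 3) n).
  by rewrite /quad /f /pw /= !chi_epsE; chi_cases n; chi_cases n'; field.
transitivity (18%:~R * (LA 1 * LA 2) + 6%:~R * (LA 0 * LA 3)).
  by ring.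
rewrite /LA ?fps_D_lambert !(lambertE, lambert2_natM, lambert2N, lambert2D).
apply: (lambert_convolution (r := (-3)) fN fG fQ) => //= d e.
by rewrite /f /G /pw /= !chi_epsE; chi_cases d; field.
Qed.

(** * Eisenstein series and the Hauptmodul *)

(* With the cubic theta functions [a] and [b]: [Ea] is [a], [Eb] is [b ^+ 3], and
   [EP] is quasimodular of weight 2. *)
Definition Ea : fps := 1 + 6 * LA 0.
Definition EP : fps := 1 - 3 * LA 1.
Definition Eb : fps := 1 - 9 * LA 2.

(** With [fps_D_EP] and [fps_D_Eb] this is the level 3 analogue of the Ramanujan system for E2, E4,
    E6. *)
Lemma fps_D_Ea : 3 * fps_D Ea = Ea * EP - Eb.
Proof.
rewrite /Ea /EP /Eb fps_DD fps_D1 fps_DnatM.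
have E := conv_LA0_LA1; apply/eqP; rewrite -subr_eq0; apply/eqP.
transitivity (3 * (6 * (LA 0 * LA 1)) -
  3 * (2 * LA 0 - LA 1 + 3 * LA 2 - 6 * fps_D (LA 0))); first by ring.
by rewrite E subrr.
Qed.

Lemma fps_D_EP : 3 * fps_D EP = EP ^+ 2 - Ea * Eb.
Proof.
rewrite /Ea /EP /Eb fps_DD fps_D1 fps_DN fps_DnatM.
have E := conv_LA1_LA1_LA0_LA2; apply/eqP; rewrite -subr_eq0; apply/eqP.
transitivity (3 * (2 * LA 1 + 2 * LA 0 - 3 * LA 2 - 3 * fps_D (LA 1)) -
  3 * (3 * LA 1 ^+ 2 + 18 * (LA 0 * LA 2))); first by ring.
by rewrite E subrr.
Qed.

(** The derivative of [LA 1] is eliminated between the two convolutions of weight 4. *)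
Lemma weight4_relation : 1 + 3 * LA 3 = Ea * Eb.
Proof.
apply: (@fps_natI 2); apply/eqP; rewrite -subr_eq0; apply/eqP.
have E1 := conv_LA1_LA1_LA0_LA2; have E2 := conv_LA1_LA1_LA0_LA2'.
rewrite /Ea /Eb; transitivity (2 * (3 * LA 1 ^+ 2 + 18 * (LA 0 * LA 2) -
  (2 * LA 1 + 2 * LA 0 - 3 * LA 2 - 3 * fps_D (LA 1))) * 3 -
  3 * (6 * LA 1 ^+ 2 - 18 * (LA 0 * LA 2) -
  (4 * LA 1 - 2 * LA 0 + 3 * LA 2 + 3 * LA 3 - 6 * fps_D (LA 1))));
  first by ring.
by rewrite E1 E2 !subrr !(mulr0, mul0r) subrr.
Qed.

Lemma fps_D_Eb : fps_D Eb = (EP - Ea ^+ 2) * Eb.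
Proof.
(* Replacing [Ea * Eb] by the weight 4 series leaves only products of two Lambert series, as in the
   convolutions. *)
have -> : (EP - Ea ^+ 2) * Eb = EP * Eb - Ea * (Ea * Eb) by ring.
rewrite -weight4_relation /Ea /EP /Eb fps_DD fps_D1 fps_DN fps_DnatM.
have E := conv_LA1_LA2_LA0_LA3; apply/eqP; rewrite -subr_eq0; apply/eqP.
transitivity (3 * (LA 1 + 3 * LA 2 + 2 * LA 0 + LA 3 - 3 * fps_D (LA 2)) -
  3 * (9 * (LA 1 * LA 2) - 6 * (LA 0 * LA 3))); first by ring.
by rewrite E subrr.
Qed.

(** The derivative of [LA 2] is eliminated between the two convolutions of weight 5; by [C_E] the
    left side is [C]. *)
Lemma weight5_relation : 1 + 3 * LA 4 = Ea ^+ 2 * Eb.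
Proof.
have -> : Ea ^+ 2 * Eb = Ea * (Ea * Eb) by ring.
rewrite -weight4_relation; apply: (@fps_natI 2).
apply/eqP; rewrite -subr_eq0; apply/eqP.
have E1 := conv_LA1_LA2_LA0_LA3; have E2 := conv_LA1_LA2_LA0_LA3'.
rewrite /Ea; transitivity (6 * (9 * (LA 1 * LA 2) - 6 * (LA 0 * LA 3) -
  (LA 1 + 3 * LA 2 + 2 * LA 0 + LA 3 - 3 * fps_D (LA 2))) -
  3 * (18 * (LA 1 * LA 2) + 6 * (LA 0 * LA 3) -
  (3 * LA 4 + 2 * LA 1 + 6 * LA 2 - 2 * LA 0 - LA 3 - 6 * fps_D (LA 2))));
  first by ring.
by rewrite E1 E2 !subrr !mulr0 subrr.
Qed.

Lemma chi3E (d : nat) : (chi3 d)%:~R = chi d :> rat.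
Proof.
rewrite /chi3 /legendre /chi /dvdn modz_nat.
have: (d %% 3 < 3)%N by rewrite ltn_mod.
case E: (d %% 3)%N => [|[|[|k]]] // _ /=.
  case: existsP => // -[]; exists (inord 1); rewrite inordK // exp1n.
case: existsP => // -[x].
by case: x => -[|[|[|k]]].
Qed.

Lemma C_E : C = 1 + 3 * LA 4.
Proof.
apply: fpsP => n; rewrite fpsDE fps_natM fps1E /C /LA /lambert /lambert2.
case: eqP => [|_]; first by rewrite mulr0 addr0.
rewrite add0r /c intrM; congr (_ * _).
rewrite rmorph_sum /=; apply: eq_bigr => d _.
by rewrite /pw /= intrM chi3E rmorphXn /= mulrC.
Qed.

Lemma lambert2_flip F : lambert2 F = lambert2 (fun d e => F e d).
Proof.
apply: fpsP => n; rewrite /lambert2; case: eqP => // /eqP; rewrite -lt0n => n0.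
have divK d : (d %| n)%N -> (n %/ (n %/ d))%N = d.
  by move=> dn; rewrite divnA // mulKn.
have divE d : (d \in divisors n) = (d %| n)%N by rewrite dvdn_divisors.
transitivity (\sum_(d <- [seq (n %/ d)%N | d <- divisors n]) F d (n %/ d)%N).
  apply/perm_big/uniq_perm; rewrite ?divisors_uniq //.
    rewrite map_inj_in_uniq ?divisors_uniq // => d e.
    by rewrite !divE => dn en E; rewrite -(divK d dn) E divK.
  move=> d; rewrite divE; apply/idP/mapP => [dn|[e]].
    by exists (n %/ d)%N; rewrite ?divE ?dvdn_div ?divK.
  by rewrite divE => en ->; apply: dvdn_div.
by rewrite big_map; apply: eq_big_seq => d; rewrite divE => dn; rewrite divK.
Qed.

(** * The logarithmic derivative of the Hauptmodul *)

Lemma fps_mulE (f g : fps) : fps_mul f g = f * g.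
Proof. by []. Qed.

Lemma fps_D_var : fps_D fps_var = fps_var.
Proof.
apply: fpsP => n; rewrite /fps_D /fps_var.
by case: eqP => [->|]; rewrite ?mulr0 // mul1r.
Qed.

Lemma fps_varM f n : (fps_var * f) n.+1 = f n.
Proof.
rewrite fpsME !big_ord_recl.
have -> : fps_var (ord0 : 'I_n.+2) = 0 by [].
have -> : fps_var (lift (ord0 : 'I_n.+2) (ord0 : 'I_n.+1)) = 1 by [].
rewrite mul0r add0r mul1r big1 ?addr0 => [|i _]; last exact: mul0r.
by congr (f _); exact: subn1.
Qed.

Lemma fps_varM0 f : (fps_var * f) 0%N = 0.
Proof. by rewrite fpsM0 mul0r. Qed.

Lemma fps_varI f g : fps_var * f = fps_var * g -> f = g.
Proof.
by move=> E; apply: fpsP => n; rewrite -[f n]fps_varM E fps_varM.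
Qed.

(** The series k q^k / (1 - q^k), minus the logarithmic derivative of 1 - q^k. *)
Definition geo (k : nat) : fps :=
  fun n => if (0 < n)%N && (k %| n)%N then k%:R else 0.

Lemma fps_invK (f : fps) : f 0%N != 0 -> f * fps_inv f = 1.
Proof. by move=> f0; apply: fpsP; apply: fps_mul_inv. Qed.

Lemma one_minus_q0 k : (0 < k)%N -> one_minus_q k 0%N = 1.
Proof. by case: k => // k _; apply: subr0. Qed.

Lemma fps_D_one_minus_q k : (0 < k)%N ->
  fps_D (one_minus_q k) = - (one_minus_q k * geo k).
Proof.
move=> k0; apply: fpsP => n; rewrite fpsNE fpsME /fps_D.
have c0 : (0 == k)%N = false by rewrite ltn_eqF.
rewrite big_ord_recl subn0 one_minus_q0 // mul1r.
have [lt_nk|le_kn] := ltnP n k.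
  rewrite big1 => [|i _]; last first.
    rewrite lift0 /one_minus_q (@ltn_eqF i.+1 k) ?subr0 ?mul0r //.
    by rewrite (leq_ltn_trans _ lt_nk) // ltn_ord.
  rewrite /one_minus_q /geo (ltn_eqF lt_nk) subr0 addr0.
  case: n lt_nk => [|n] lt_nk /=; first by rewrite mul0r oppr0.
  by rewrite gtnNdvd // mulr0 oppr0.
have n0 : (0 < n)%N by apply: leq_trans le_kn.
have lt : (k.-1 < n)%N by rewrite prednK.
rewrite (bigD1 (Ordinal lt)) //= big1 ?addr0; last first.
  move=> i; rewrite -val_eqE /= /bump /= add1n => ne.
  rewrite /one_minus_q; have -> : (i.+1 == k) = false by lia.
  by rewrite subr0 mul0r.
rewrite /bump /= add1n prednK // /one_minus_q eqxx [(k == 0)%N]eq_sym c0 sub0r mulN1r.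
rewrite [(n == 0)%N]eq_sym (ltn_eqF n0) sub0r.
rewrite /geo n0 /= subn_gt0; have [->|ne] := eqVneq n k.
  by rewrite dvdnn ltnn /= subr0 mulrN1.
have lt_kn : (k < n)%N by rewrite ltn_neqAle eq_sym ne.
by rewrite lt_kn /= dvdn_subl ?subrr ?oppr0 ?mulr0 // ltnW.
Qed.

Lemma fps_D_inv (f g : fps) : f 0%N != 0 -> fps_D f = - (f * g) ->
  fps_D (fps_inv f) = fps_inv f * g.
Proof.
move=> f0 Df; apply: (fps_mulIf f0).
have := congr1 fps_D (fps_invK f0); rewrite fps_DM fps_D1 Df => /eqP.
rewrite mulNr addrC subr_eq0 => /eqP ->; by ring.
Qed.

Lemma fps_D_t_factor k : (0 < k)%N ->
  fps_D (t_factor k) = t_factor k * (12 * (geo k - geo (3 * k)%N)).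
Proof.
move=> k0; have k30 : (0 < 3 * k)%N by rewrite muln_gt0.
rewrite /t_factor !fps_expE fps_mulE fps_DM !fps_DX fps_D_one_minus_q //.
have -> : fps_D (fps_inv (one_minus_q k)) = fps_inv (one_minus_q k) * geo k.
  by apply: fps_D_inv; rewrite ?one_minus_q0 ?fps_D_one_minus_q.
by ring.
Qed.

Lemma fps_D_partprod N :
  fps_D (fps_partprod t_factor N) = fps_partprod t_factor N *
    (12 * \sum_(k < N) (geo k.+1 - geo (3 * k.+1)%N)).
Proof.
elim: N => [|N IH]; first by rewrite big_ord0 !mulr0; apply: fps_D1.
rewrite /= fps_mulE fps_DM IH fps_D_t_factor //.
by rewrite big_ord_recr /=; ring.
Qed.

(** A divisor k of n contributes k if 3 does not divide n/k, and k - 3k if it does; either way this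
    is -k [eps (n/k)]. *)
Lemma sum_geo N n : (n <= N)%N ->
  (\sum_(k < N) (geo k.+1 - geo (3 * k.+1)%N)) n =
  - lambert2 (fun d e => e%:R * eps d) n.
Proof.
move=> le_nN; rewrite lambert2_flip fps_sumE /lambert2.
case: eqP => [->|/eqP]; first by rewrite oppr0 big1 // => i _; rewrite fpsBE /geo subrr.
rewrite -lt0n => n0; rewrite -sumrN (sum_divisors_ord _ (N := N)) ?n0 //.
rewrite [RHS]big_mkcond big_ord_recl /= add0r; apply: eq_bigr => i _.
rewrite fpsBE /geo n0 /bump /= add1n; case: ifP => dn; last first.
  have -> : (3 * i.+1 %| n)%N = false.
    by apply: contraFF dn; apply: dvdn_trans; apply: dvdn_mull.
  by rewrite subrr.
rewrite -{1}(divnK dn) dvdn_pmul2r // /eps modz_nat /dvdn natrM.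
by case: (_ %% 3)%N => [|k] /=; rewrite ?subr0; ring.
Qed.

Lemma Ea_sqr : Ea ^+ 2 = 1 - 12 * lambert2 (fun d e => e%:R * eps d).
Proof.
have E := conv_LA0_LA0; rewrite /Ea; apply/eqP; rewrite -subr_eq0; apply/eqP.
transitivity (12 * (3 * LA 0 ^+ 2) - 12 *
  (- lambert2 (fun d e => e%:R * eps d) - LA 0)); first by ring.
by rewrite E subrr.
Qed.

Lemma fps_D_t : fps_D t = Ea ^+ 2 * t.
Proof.
rewrite /t fps_mulE fps_DM fps_D_var.
suff -> : fps_D (fps_infprod t_factor) =
    fps_infprod t_factor * (12 * - lambert2 (fun d e => e%:R * eps d)).
  by rewrite Ea_sqr; ring.
apply: fpsP => n.
(* Coefficient n of the infinite product is by definition that of the n-th partial product. *)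
have -> : fps_D (fps_infprod t_factor) n = fps_D (fps_partprod t_factor n) n by [].
rewrite fps_D_partprod !fpsME; apply: eq_bigr => i _.
rewrite t_partprod_stable -1?ltnS // !fps_natM sum_geo ?leq_subr //.
Qed.

Lemma fpsM1 (f g : fps) : (f * g) 1%N = f 0%N * g 1%N + f 1%N * g 0%N.
Proof. by rewrite fpsME !big_ord_recl big_ord0 addr0. Qed.

Lemma LA_0 k : LA k 0%N = 0. Proof. by []. Qed.
Lemma LA_1 k : LA k 1%N = if odd k then -1 else 1.
Proof. by rewrite /LA /lambert /lambert2 /= big_seq1 /pw expr1n mul1r; case: odd. Qed.

(** Both sides solve D y = [EP] y, and [EP] has constant term 1, so the coefficients of q decide.
    With c^3 = 27 b^3 t this is the cubic theta identity a^3 = b^3 + c^3. *)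
Lemma cubic_relation : Ea ^+ 3 - Eb = 27 * (Eb * t).
Proof.
apply: (@fps_ode_unique 1 EP).
- by rewrite /EP fpsBE fps1E fps_natM LA_0 mulr0 subr0.
- rewrite fps_DD fps_DN fps_DX fps_D_Eb.
  have := fps_D_Ea; set D := fps_D Ea => E; apply/eqP; rewrite -subr_eq0; apply/eqP.
  transitivity (Ea ^+ 2 * (3 * D - (Ea * EP - Eb))); first by ring.
  by rewrite E subrr mulr0.
- by rewrite fps_DnatM fps_DM fps_D_Eb fps_D_t; ring.
rewrite fpsBE fps_natM fpsM1 t0 t1 !exprS expr0 mulr1 !(fpsM1, fpsM0).
rewrite /Ea /Eb !(fpsDE, fpsBE, fpsNE, fps_natM, fps1E, LA_0, LA_1) /=.
by ring.
Qed.

(** * The hypergeometric equation and the congruence *)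

Lemma fps_mulX_low (f g : fps) (k n : nat) :
  f 0%N = 0 -> (n < k)%N -> (g * f ^+ k) n = 0.
Proof.
move=> f0; elim: k g n => // k IH g n lt.
rewrite exprS mulrA [g * f]mulrC -mulrA fpsME big_ord_recl f0 mul0r add0r big1 // => i _.
by rewrite lift0 IH ?mulr0 //; have := ltn_ord i; lia.
Qed.

Lemma inord_gt (n k : nat) : (n < k)%N -> (inord k : 'I_n.+1) = ord0.
Proof.
move=> lt; apply: val_inj; rewrite /= /inord /insubd insubF //.
by apply/negbTE; rewrite -leqNgt.
Qed.

(* The truncation is harmless: [t ^+ k] vanishes below degree [k]. *)
Definition comp_t (phi : fps) : fps := fun n => \sum_(k < n.+1) phi k * (t ^+ k) n.

(** A truncation bound common to all coefficients lets the sum over powers of [t] pass through the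
    Cauchy product. *)
Lemma mul_comp_t (g phi : fps) (N n : nat) : (n <= N)%N ->
  (g * comp_t phi) n = \sum_(k < N.+1) phi k * (g * t ^+ k) n.
Proof.
move=> le_nN; rewrite fpsME.
transitivity (\sum_(i < n.+1) \sum_(k < N.+1) phi k * (g i * (t ^+ k) (n - i)%N)).
  apply: eq_bigr => i _; rewrite /comp_t mulr_sumr.
  rewrite (big_ord_widen N.+1 (fun k => g i * (phi k * (t ^+ k) (n - i)%N))); last first.
    by rewrite ltnS (leq_trans (leq_subr _ _)).
  rewrite big_mkcond; apply: eq_bigr => k _; case: ltnP => [_|lt]; first by rewrite mulrCA.
  by rewrite -[t ^+ k]mul1r (fps_mulX_low _ t0) // !mulr0.
rewrite exchange_big; apply: eq_bigr => k _.
by rewrite fpsME mulr_sumr.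
Qed.

Lemma comp_tE (phi : fps) (N n : nat) : (n <= N)%N ->
  comp_t phi n = \sum_(k < N.+1) phi k * (t ^+ k) n.
Proof.
move=> le_nN; rewrite -[comp_t phi]mul1r (mul_comp_t _ _ le_nN).
by apply: eq_bigr => k _; rewrite mul1r.
Qed.

Lemma comp_tM phi psi : comp_t (phi * psi) = comp_t phi * comp_t psi.
Proof.
apply: fpsP => n; rewrite (mul_comp_t _ _ (leqnn n)).
transitivity (\sum_(k < n.+1) \sum_(l < n.+1) psi k * (phi l * (t ^+ (k + l)) n)).
  pose F k l := psi k * (phi l * (t ^+ (k + l)) n).
  rewrite /comp_t.
  transitivity (\sum_(j < n.+1) \sum_(k < n.+1 | (k <= j)%N) F k (j - k)%N).
    apply: eq_bigr => j _; rewrite mulrC [phi * psi]mulrC fpsME mulr_sumr.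
    rewrite (big_ord_widen n.+1 (fun k => (t ^+ j) n * (psi k * phi (j - k)%N))) //.
    apply: eq_bigr => k le_kj; rewrite /F subnKC //; first by ring.
  rewrite (exchange_big_dep predT) //=; apply: eq_bigr => k _.
  rewrite [RHS](bigID (fun l : 'I_n.+1 => (k + l <= n)%N)) /=.
  (* Pairs with k + l > n contribute nothing, as the power of [t] starts in degree k + l; the others
     are grouped by j = k + l. *)
  rewrite [X in _ + X]big1 ?addr0; last first.
    move=> l; rewrite -ltnNge => lt.
    by rewrite -[t ^+ _]mul1r (fps_mulX_low _ t0) // !mulr0.
  rewrite (reindex_onto (fun l : 'I_n.+1 => inord (k + l))
    (fun j : 'I_n.+1 => inord (j - k))) /=.
    apply: eq_big => [l|l /andP[le _]].
      have [le|lt] := leqP (k + l) n.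
        by rewrite inordK ?ltnS // leq_addr addKn inord_val eqxx.
      (* The overflow value 0 passes the test k <= j only for k = 0, and then l > n is
         impossible. *)
      have -> : (inord (k + l) : 'I_n.+1) = ord0.
        by rewrite inord_gt.
      rewrite /= leqn0; case: eqP => // k0; rewrite k0 in lt.
      by have := ltn_ord l; rewrite ltnNge lt.
    have [le'|lt] := leqP (k + l) n; first by rewrite inordK ?ltnS // addKn.
    exfalso; move: le.
    have -> : (inord (k + l) : 'I_n.+1) = ord0.
      by rewrite inord_gt.
    rewrite leqn0 => /eqP k0; rewrite k0 in lt.
    by have := ltn_ord l; rewrite ltnNge lt.
  move=> j le; have lt := ltn_ord j.
  by rewrite inordK ?subnKC ?inord_val // (leq_ltn_trans (leq_subr _ _)).
apply: eq_bigr => k _; rewrite -mulr_sumr mulrC [in RHS]mulrC; congr (_ * _).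
rewrite [comp_t phi * _]mulrC (mul_comp_t _ _ (leqnn n)).
by apply: eq_bigr => l _; rewrite exprD.
Qed.

Lemma comp_tD phi psi : comp_t (phi + psi) = comp_t phi + comp_t psi.
Proof.
apply: fpsP => n; rewrite fpsDE /comp_t -big_split.
by apply: eq_bigr => k _; rewrite mulrDl.
Qed.

Lemma comp_tN phi : comp_t (- phi) = - comp_t phi.
Proof.
apply: fpsP => n; rewrite fpsNE /comp_t -sumrN.
by apply: eq_bigr => k _; rewrite mulNr.
Qed.

Lemma comp_t_natM k phi : comp_t (k%:R * phi) = k%:R * comp_t phi.
Proof.
apply: fpsP => n; rewrite fps_natM /comp_t mulr_sumr.
by apply: eq_bigr => i _; rewrite fps_natM mulrA.
Qed.

Lemma comp_t_var : comp_t fps_var = t.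
Proof.
apply: fpsP => n; rewrite (comp_tE _ (leqnSn n)) !big_ord_recl big1 => [|i _].
  by rewrite /fps_var /= mul0r add0r addr0 mul1r expr1.
by rewrite /fps_var /= mul0r.
Qed.

Lemma comp_t0 phi : comp_t phi 0%N = phi 0%N.
Proof. by rewrite /comp_t big_ord1 expr0 fps1E mulr1. Qed.

(** Chain rule: Dt = a^2 t, so D multiplies t^k by k a^2, and q d/dq becomes a^2 times z d/dz. *)
Lemma fps_D_comp_t phi : fps_D (comp_t phi) = Ea ^+ 2 * comp_t (fps_D phi).
Proof.
apply: fpsP => n; rewrite (mul_comp_t _ _ (leqnn n)) /comp_t {1}/fps_D mulr_sumr.
apply: eq_bigr => k _; rewrite mulrCA -/(fps_D (t ^+ k) n) /fps_D.
rewrite -[n%:R * _]/(fps_D (t ^+ k) n).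
case: (k : nat) => [|j]; first by rewrite expr0 fps_D1 !mul0r mulr0.
rewrite fps_DX fps_D_t.
have -> : j.+1%:R * t ^+ j * (Ea ^+ 2 * t) = j.+1%:R * (Ea ^+ 2 * t ^+ j.+1).
  by rewrite (exprS t); ring.
by rewrite fps_natM mulrCA mulrA.
Qed.

(** * The hypergeometric equation and its pullback along [t] *)

Definition phi0 : fps := fun n => (- 27) ^+ n * hyp2F1 (1 / 3%:R) (1 / 3%:R) 1 n.

(** With theta = z d/dz this is theta^2 = -27 z (theta + 1/3)^2, where 9 (theta + 1/3)^2 is expanded
    to keep the coefficients integral. *)
Lemma phi0_ode : fps_D (fps_D phi0) =
  - (3 * (fps_var * (9 * fps_D (fps_D phi0) + 6 * fps_D phi0 + phi0))).
Proof.
apply: fpsP => -[|n].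
  by rewrite fpsNE fps_natM fps_varM0 mulr0 oppr0 /fps_D mul0r.
rewrite fpsNE fps_natM fps_varM !fpsDE !fps_natM /fps_D /phi0 /hyp2F1 /pochhammer.
rewrite !big_ord_recr /= factS natrM exprS.
set p := \prod_(i < n) _; set r := \prod_(i < n) _.
have r0 : r != 0.
  by apply/prodf_neq0 => i _; rewrite -[1]/(1%:R) -natrD pnatr_eq0.
have f0 : (n`!)%:R != 0 :> rat by rewrite pnatr_eq0 -lt0n fact_gt0.
have n1 : n%:R + 1 != 0 :> rat by rewrite natr1 pnatr_eq0.
rewrite -natr1; field.
by rewrite f0 r0.
Qed.

(* [w3 / 3] is the logarithmic derivative of the cubic theta function [b]. *)
Definition w3 : fps := EP - Ea ^+ 2.

Lemma comp_phi0_ode2 : 3 * fps_D (fps_D (comp_t phi0)) =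
  2 * w3 * fps_D (comp_t phi0) - 9 * (Ea * Eb * t) * comp_t phi0.
Proof.
set Y := comp_t phi0; pose Y1 := comp_t (fps_D phi0).
pose Y2 := comp_t (fps_D (fps_D phi0)).
have EY2 : Y2 = - (3 * (t * (9 * Y2 + 6 * Y1 + Y))).
  rewrite {1}/Y2 phi0_ode comp_tN !(comp_t_natM, comp_tM, comp_tD).
  by rewrite comp_t_var.
have DY : fps_D Y = Ea ^+ 2 * Y1 by rewrite fps_D_comp_t.
have DY1 : fps_D Y1 = Ea ^+ 2 * Y2 by rewrite fps_D_comp_t.
rewrite DY fps_DM DY1 fps_DX expr1 /w3.
have Da := fps_D_Ea; have cub := cubic_relation.
set D := fps_D Ea in Da *.
apply/eqP; rewrite -subr_eq0; apply/eqP.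
(* The cubic relation reads a^3 = b^3 (1 + 27 t), and 1 + 27 t is the leading coefficient of the
   hypergeometric equation. Hence a^4 [Y2] is a combination of [Y1] and [Y]. *)
transitivity (2 * Ea * Y1 * (3 * D - (Ea * EP - Eb)) +
  3 * Ea * Y2 * (Ea ^+ 3 - Eb - 27 * (Eb * t)) +
  3 * Ea * Eb * (Y2 + 3 * (t * (9 * Y2 + 6 * Y1 + Y))) +
  2 * Ea * Y1 * (Ea ^+ 3 - Eb - 27 * (Eb * t))); first by ring.
have EY2' : Y2 + 3 * (t * (9 * Y2 + 6 * Y1 + Y)) = 0 by rewrite {1}EY2 addNr.
by rewrite Da cub EY2' !subrr !mulr0 !addr0.
Qed.

(** For w = w3 / 3 this Riccati equation says w^2 - Dw = 3 a b^3 t, so that (D - w)(D - w) has the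
    required term of order zero. *)
Lemma fps_D_w3 : 3 * fps_D w3 = w3 ^+ 2 - 27 * (Ea * Eb * t).
Proof.
rewrite /w3 fps_DD fps_DN fps_DX expr1.
have Da := fps_D_Ea; have DP := fps_D_EP; have cub := cubic_relation.
set D := fps_D Ea in Da *; set D' := fps_D EP in DP *.
apply/eqP; rewrite -subr_eq0; apply/eqP.
transitivity ((3 * D' - (EP ^+ 2 - Ea * Eb)) - 2 * Ea * (3 * D - (Ea * EP - Eb))
  - Ea * (Ea ^+ 3 - Eb - 27 * (Eb * t))); first by ring.
by rewrite Da DP cub !subrr !mulr0 !subrr.
Qed.

Lemma w3_0 : w3 0%N = 0.
Proof.
rewrite /w3 fpsBE exprS expr1 fpsM0 /Ea /EP.
rewrite !(fpsDE, fpsBE, fpsNE, fps_natM, fps1E, LA_0) eqxx /=.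
by ring.
Qed.

(* The operator of [comp_phi0_ode2] factors as [(D - w) (D - w)], where
   [w = w3 / 3]. *)
Lemma fps_D_comp_phi0 : 3 * fps_D (comp_t phi0) = w3 * comp_t phi0.
Proof.
set Y := comp_t phi0; apply/eqP; rewrite -subr_eq0; apply/eqP.
set W := 3 * fps_D Y - w3 * Y.
have DW : 3 * fps_D W = w3 * W.
  rewrite /W fps_DD fps_DN fps_DnatM fps_DM.
  have E := comp_phi0_ode2; have Ew := fps_D_w3; rewrite -/Y in E.
  apply/eqP; rewrite -subr_eq0; apply/eqP.
  transitivity (3 * (3 * fps_D (fps_D Y) - (2 * w3 * fps_D Y - 9 * (Ea * Eb * t) * Y)) -
    Y * (3 * fps_D w3 - (w3 ^+ 2 - 27 * (Ea * Eb * t)))); first by ring.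
  by rewrite E Ew !subrr !mulr0 subrr.
suff -> : W = 0 by [].
(* This is w itself: [fps_ode0] needs an equation without the factor 3. Its constant term is 0, so
   the constant term of [W] is the one to check. *)
pose third : fps := fun n => 3^-1 * w3 n.
have third3 : 3 * third = w3 by apply: fpsP => n; rewrite fps_natM mulVKf.
apply: (@fps_ode0 0 third); first by rewrite /third w3_0 mulr0.
  by apply: (@fps_natI 2); rewrite DW mulrA third3.
by rewrite /W fpsBE fps_natM fpsM0 w3_0 mul0r {1}/fps_D mul0r mulr0 subrr.
Qed.

(** Both sides have logarithmic derivative [w3] and constant term 1. *)
Lemma comp_phi0_cube : comp_t phi0 ^+ 3 = Eb.
Proof.
apply: (@fps_ode_unique 0 w3); first exact: w3_0.
- by rewrite fps_DX -mulrA [_ ^+ 2 * _]mulrC mulrA fps_D_comp_phi0 -mulrA -exprS.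
- exact: fps_D_Eb.
rewrite !exprS expr0 mulr1 !fpsM0 comp_t0 /phi0 /hyp2F1 /pochhammer !big_ord0.
by rewrite /Eb fpsBE fps1E fps_natM LA_0.
Qed.

(** The substitution of -27 z for z is multiplicative, so it commutes with the cube. *)
Lemma B_E : B =1 phi0 ^+ 3.
Proof.
pose sc (f : fps) : fps := fun n => (- 27) ^+ n * f n.
have scM f g : sc f * sc g = sc (f * g).
  apply: fpsP => k; rewrite fpsME /sc fpsME mulr_sumr; apply: eq_bigr => i _.
  by rewrite mulrACA -exprD subnKC // -ltnS.
move=> n; rewrite /B /A fps_expE mulrA -exprMn mulN1r.
have -> : phi0 = sc (hyp2F1 (1 / 3%:R) (1 / 3%:R) 1) by [].
by rewrite !(exprS, expr0, mulr1) !scM.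
Qed.

(** * The residue computation *)

Lemma HtE : H * t = fps_var.
Proof. by apply: fpsP; apply: H_mul_t. Qed.

Lemma fps_D_H : fps_D H = H - Ea ^+ 2 * H.
Proof.
(* Since [t] has no constant term it cannot be cancelled directly; q = [H * t] is cancelled
   instead. *)
apply: fps_varI; rewrite -HtE.
have := congr1 fps_D HtE; rewrite fps_D_var fps_DM fps_D_t -{1}HtE => E.
transitivity (H * (fps_D H * t + H * (Ea ^+ 2 * t)) - H * H * Ea ^+ 2 * t); first by ring.
by rewrite E; ring.
Qed.

Lemma fps_varX k f n : (k <= n)%N -> (fps_var ^+ k * f) n = f (n - k)%N.
Proof.
elim: k n => [|k IH] n; first by rewrite expr0 mul1r subn0.
by case: n => // n le; rewrite exprS -mulrA fps_varM IH.
Qed.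

(** For j > 0, t^(-j) Dt/t = -D(t^(-j)) / j is a derivative and has no constant term; multiplying by
    q^j moves this coefficient to degree j. *)
Lemma residue_H j : (Ea ^+ 2 * H ^+ j) j = (j == 0%N)%:R.
Proof.
case: j => [|j].
  rewrite mulr1 Ea_sqr fpsBE fps1E fps_natM /lambert2 /=.
  by rewrite mulr0 subr0.
have E : j.+1%:R * (Ea ^+ 2 * H ^+ j.+1) = j.+1%:R * H ^+ j.+1 - fps_D (H ^+ j.+1).
  by rewrite fps_DX fps_D_H (exprS H); ring.
move/(congr1 (fun f : fps => f j.+1)): E.
rewrite fpsBE !fps_natM /fps_D subrr => /eqP.
by rewrite mulf_eq0 pnatr_eq0 /= => /eqP.
Qed.

(* [C] is [\sum_k B_k t^k] times [(q dt/dq) / t], so that this is the residue of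
   [\sum_k B_k t^(k - m) dt/t]. *)
Lemma C_H_coef m : (C * H ^+ m) m = B m.
Proof.
have -> : C * H ^+ m = (Ea ^+ 2 * H ^+ m) * comp_t (phi0 ^+ 3).
  have -> : comp_t (phi0 ^+ 3) = Eb.
    by rewrite -comp_phi0_cube !exprS !expr0 !mulr1 !comp_tM.
  by rewrite C_E weight5_relation; ring.
rewrite (mul_comp_t _ _ (leqnn m)) B_E big_ord_recr /= big1 ?add0r => [|k _].
  rewrite -mulrA -exprMn HtE mulrC [Ea ^+ 2 * _]mulrC fps_varX // subnn.
  by have := residue_H 0; rewrite expr0 mulr1 => ->; rewrite mul1r.
have -> : Ea ^+ 2 * H ^+ m * t ^+ k = fps_var ^+ k * (Ea ^+ 2 * H ^+ (m - k)).
  by rewrite -HtE (exprMn k H t) -{1}(subnKC (ltnW (ltn_ord k))) exprD; ring.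
by rewrite fps_varX 1?ltnW // residue_H subn_eq0 leqNgt ltn_ord mulr0.
Qed.

(** * Integrality, dilation by p and the reduction modulo p^4 *)

Definition fps_int (f : fps) := forall n, f n \is a Num.int.

Lemma fps_int_mul f g : fps_int f -> fps_int g -> fps_int (fps_mul f g).
Proof. by move=> fi gi n; apply: rpred_sum => i _; apply: rpredM. Qed.

Lemma fps_int_one : fps_int fps_one.
Proof. by move=> n; apply: natr_int. Qed.

Lemma fps_int_exp f k : fps_int f -> fps_int (fps_exp f k).
Proof.
by move=> fi; elim: k => [|k IH]; [apply: fps_int_one|apply: fps_int_mul].
Qed.

Lemma fps_int_inv f : f 0%N = 1 -> fps_int f -> fps_int (fps_inv f).
Proof.
move=> f0 fi; elim/ltn_ind => n IH.
have fn0 : f 0%N != 0 by rewrite f0 oner_neq0.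
have := fps_mul_inv fn0 n; rewrite /fps_mul big_ord_recl f0 mul1r subn0.
move/(canRL (addrK _)) => ->; apply: rpredB; first exact: natr_int.
apply: rpred_sum => i _; apply: rpredM => //; apply: IH.
by have := ltn_ord i; rewrite lift0; lia.
Qed.

Lemma fps_int_one_minus_q k : fps_int (one_minus_q k).
Proof. by move=> n; apply: rpredB; apply: natr_int. Qed.

Lemma fps_int_H : fps_int H.
Proof.
have tfi k : (0 < k)%N -> fps_int (t_factor k).
  move=> k0; apply: fps_int_mul; apply: fps_int_exp;
      first exact: fps_int_one_minus_q.
  by apply: fps_int_inv; [apply: one_minus_q0|apply: fps_int_one_minus_q].
have ti : fps_int t.
  apply: fps_int_mul => n; first exact: natr_int.
  rewrite /fps_infprod; move: {2}n => k.
  elim: n k => [|n IH] k; first exact: fps_int_one.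
  by apply: fps_int_mul => // i; apply: tfi.
apply: fps_int_inv; first exact: t1.
by move=> n; apply: ti.
Qed.

Lemma fps_dil1 p : (0 < p)%N -> fps_dil p 1 = 1.
Proof.
move=> p0; apply: fpsP => n; rewrite /fps_dil !fps1E.
case: dvdnP => [[k ->]|nd].
  by rewrite mulnK // muln_eq0 [(p == 0)%N]eqn0Ngt p0 orbF.
by case: eqP => // n0; case: nd; exists 0%N; rewrite n0.
Qed.

(** An index i contributes only if p divides n p - i, that is, if p divides i. *)
Lemma mul_fps_dil (p n : nat) (f g : fps) : (0 < p)%N ->
  (f * fps_dil p g) (n * p)%N = \sum_(k < n.+1) f (p * k)%N * g (n - k)%N.
Proof.
move=> p0; rewrite fpsME (bigID (fun i : 'I_(n * p).+1 => (p %| i)%N)) /=.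
rewrite [X in _ + X]big1 ?addr0; last first.
  move=> i ni; rewrite /fps_dil dvdn_subr ?dvdn_mull -1?ltnS //.
  by rewrite (negPf ni) mulr0.
rewrite (reindex_onto (fun k : 'I_n.+1 => inord (p * k))
  (fun i : 'I_(n * p).+1 => inord (i %/ p))) /=.
  have E (k : 'I_n.+1) : (inord (p * k) : 'I_(n * p).+1) = (p * k)%N :> nat.
    by rewrite inordK // ltnS mulnC leq_pmul2r // -ltnS.
  apply: eq_big => [k|k _]; first by rewrite E dvdn_mulr // mulKn // inord_val eqxx.
  by rewrite E /fps_dil mulnC -mulnBl dvdn_mull // mulnK.
move=> i di; apply: val_inj => /=.
have lt : (i %/ p < n.+1)%N 
  by rewrite ltn_divLR // mulSn (leq_trans (ltn_ord i)) // -add1n leq_add2r.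
have e : (p * (i %/ p))%N = i by rewrite mulnC divnK.
by rewrite (inordK lt) e inordK.
Qed.

Lemma fps_dilM p (f g : fps) : (0 < p)%N ->
  fps_dil p (f * g) = fps_dil p f * fps_dil p g.
Proof.
move=> p0; apply: fpsP => n; rewrite {1}/fps_dil; case: dvdnP => [[k ->]|nd].
  rewrite mulnK // mul_fps_dil // fpsME; apply: eq_bigr => i _.
  by rewrite /fps_dil dvdn_mulr // mulKn.
rewrite fpsME big1 // => i _; rewrite /fps_dil.
case: ifP => di; last by rewrite mul0r.
case: ifP => dj; last by rewrite mulr0.
by case: nd; apply/dvdnP; rewrite -(subnKC (_ : i <= n)%N) ?dvdn_add // -ltnS.
Qed.

Lemma fps_dilX p (f : fps) k : (0 < p)%N -> fps_dil p (f ^+ k) = fps_dil p f ^+ k.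
Proof.
move=> p0; elim: k => [|k IH]; first by rewrite !expr0 fps_dil1.
by rewrite !exprS fps_dilM // IH.
Qed.

(** A divisor d of p k that does not divide k is a multiple of p, by the Gauss lemma; hence d^4 =
    p^4 (d/p)^4. *)
Lemma c_mul_prime p k : prime p -> (0 < k)%N ->
  exists z : int, c (p * k) - c k = p%:Z ^+ 4 * z.
Proof.
move=> pp k0; have p0 := prime_gt0 pp.
pose z := \sum_(d <- divisors (p * k) | ~~ (d %| k)%N) chi3 d * (d %/ p)%N%:Z ^+ 4.
exists (3 * z); rewrite /c -mulrBr mulrCA; congr (_ * _).
rewrite (bigID (fun d => (d %| k)%N)) /=.
have -> : \sum_(d <- divisors (p * k) | (d %| k)%N) chi3 d * d%:Z ^+ 4 =
    \sum_(d <- divisors k) chi3 d * d%:Z ^+ 4.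
  rewrite -big_filter; apply/perm_big/uniq_perm; rewrite ?filter_uniq ?divisors_uniq //.
  move=> d; rewrite mem_filter -!dvdn_divisors ?muln_gt0 ?p0 // andb_idr //.
  exact: dvdn_mull.
rewrite addrC addrK mulr_sumr big_seq_cond [RHS]big_seq_cond; apply: eq_bigr => d.
rewrite -dvdn_divisors ?muln_gt0 ?p0 // => /andP[dpk ndk].
have pd : (p %| d)%N.
  apply: contraR ndk => npd; rewrite -(Gauss_dvdr _ (_ : coprime d p)) //.
  by rewrite coprime_sym prime_coprime.
by rewrite -{2}(divnK pd) PoszM exprMn; ring.
Qed.

Theorem theorem4p5 (p m : nat) (hp : prime p) (hp5 : (5 <= p)%N)
  (hm : (1 <= m)%N) :
  congr_loc p 4 (M m p) (B m).
Proof.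
have p0 := prime_gt0 hp.
have Ck k : exists z : int, C (p * k)%N - C k = p%:R ^+ 4 * z%:~R.
  (* The constant term of [C] is 1 by definition and not a value of [c]. *)
  case: k => [|k]; first by exists 0; rewrite muln0 subrr mulr0.
  have [z E] := c_mul_prime hp (ltn0Sn k); exists z.
  rewrite /C muln_eq0 -[p == 0%N]leqn0 leqNgt p0 /= -rmorphB /= E rmorphM rmorphXn.
  by [].
have intH k : (H ^+ m) k \is a Num.int by rewrite -fps_expE; apply/fps_int_exp/fps_int_H.
(* The quotient by p^4 is even an integer, because [H] has integral coefficients. *)
suff [z E] : exists z : int, M m p - B m = p%:R ^+ 4 * z%:~R.
  by exists z%:~R; rewrite // /Zloc unfold_in /= denq_int coprimen1.
(* Both numbers become sums over k against the coefficient of q^(m - k) in [H ^+ m], one with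
   [C (p * k)], the other with [C k], and are compared term by term. *)
rewrite /M fps_mulE fps_expE -fps_dilX // mul_fps_dil // -C_H_coef fpsME -sumrB.
elim/big_ind: _ => [|_ _ [z1 ->] [z2 ->]|i _].
- by exists 0; rewrite mulr0.
- by exists (z1 + z2); rewrite intrD mulrDr.
rewrite -mulrBl; have [z ->] := Ck i; have /intrP[z' ->] := intH (m - i)%N.
by exists (z * z'); rewrite intrM mulrA.
Qed.
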